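(* Let $J$ be a $\times d$-invariant set satisfying (i) $d$ is prime and (ii) $0,d-1\in E$ and $E$ contains no two integers differing by $1$; let $\delta$ be its Hausdorff dimension and $\mu=\mathcal{H}^\delta|_J/\mathcal{H}^\delta(J)$. Let $x\in J$ be $\mu$-generic (i.e. the statement holds for $\mu$-almost every $x\in J$). Fix any $\psi:\mathbb{N}\to(0,\infty)$ and let $f$ be a dimension function such that $t\mapsto t^{-\delta}f(t)$ is monotonic. Let $\mathrm{WA}_{\psi,\mathrm{int}}$ denote the set of points $y\in J_x$ that are intrinsically well approximable (relative to $J_x$) with respect to $\psi$. Then \[ \mathcal{H}^f(\mathrm{WA}_{\psi,\mathrm{int}})=\begin{cases}0&\text{if }\sum_{n=1}^\infty f\big(\psi(d^n)/d^n\big)\,(d^n)^\delta<\infty,\\ \mathcal{H}^f(J)&\text{if }\sum_{n=1}^\infty f\big(\psi(d^n)/d^n\big)\,(d^n)^\delta=\infty,\end{cases} \] where $\mathcal{H}^f$ denotes Hausdorff $f$-measure.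
   Context: Fix an integer $d\ge2$ and $E\subseteq\{0,\dots,d-1\}$ with $1<\#E<d$. The $\times d$-invariant set is $J=\{x\in[0,1]: x=\sum_{i\ge1}a_id^{-i}\text{ with all }a_i\in E\}$. For $x\in\mathbb{R}$, $J_x=\{t-x:t\in J\}$. A dimension function is a nondecreasing continuous $f:(0,\infty)\to(0,\infty)$ with $f(t)\to0$ as $t\to0$. For $S\subseteq\mathbb{R}$, $\psi:\mathbb{N}\to(0,\infty)$: $y\in S$ is intrinsically approximable w.r.t. $\psi$ if there are infinitely many $p/q\in\mathbb{Q}\cap S$ (lowest terms) with $|y-p/q|\le\psi(q)/q$; badly intrinsically approximable if for some $\varepsilon>0$ it is not intrinsically approximable w.r.t. $\varepsilon\psi$; intrinsically well approximable otherwise. *)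

(* Defs.v *)
From Stdlib Require Import Reals Lra Lia ZArith Znumtheory List Classical ClassicalEpsilon.
Open Scope R_scope.

Inductive Rbar : Type := Fin (r : R) | PInf | MInf.

Definition Rbar_le (a b : Rbar) : Prop :=
  match a, b with
  | MInf, _ => True
  | _, PInf => True
  | PInf, _ => False
  | _, MInf => False
  | Fin x, Fin y => x <= y
  end.

(** addition, only used on nonnegative values (PInf absorbing) *)
Definition Rbar_plus (a b : Rbar) : Rbar :=
  match a, b with
  | Fin x, Fin y => Fin (x + y)
  | MInf, _ | _, MInf => MInf
  | _, _ => PInf
  end.

Definition is_ERlub (P : Rbar -> Prop) (s : Rbar) : Prop :=
  (forall v, P v -> Rbar_le v s) /\
  (forall u, (forall v, P v -> Rbar_le v u) -> Rbar_le s u).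

Lemma ERlub_ex (P : Rbar -> Prop) : exists s, is_ERlub P s.
Proof.
destruct (classic (P PInf)) as [HP|HnP].
- exists PInf. split.
  + intros v _; destruct v; simpl; auto.
  + intros u Hu. exact (Hu _ HP).
- set (E := fun r => P (Fin r)).
  destruct (classic (exists r, E r)) as [Hne|Hem].
  + destruct (classic (bound E)) as [Hb|Hnb].
    * destruct (completeness E Hb Hne) as [m [Hub Hlub]].
      exists (Fin m). split.
      -- intros v Hv; destruct v; simpl; auto;
         try (apply Hub; exact Hv); try contradiction.
      -- intros u Hu. destruct u; simpl.
         ++ apply Hlub. intros x Hx. exact (Hu _ Hx).
         ++ exact I.
         ++ destruct Hne as [r Hr]. exact (Hu _ Hr).
    * exists PInf. split.
      -- intros v _; destruct v; simpl; auto.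
      -- intros u Hu. destruct u; simpl; auto.
         ++ apply Hnb. exists r. intros x Hx. exact (Hu _ Hx).
         ++ destruct Hne as [r Hr]; exact (Hu _ Hr).
  + exists MInf. split.
    * intros v Hv. destruct v; simpl; auto.
      apply Hem; exists r; exact Hv.
    * intros; simpl; auto.
Qed.

Definition ERsup (P : Rbar -> Prop) : Rbar :=
  proj1_sig (constructive_indefinite_description _ (ERlub_ex P)).

Definition ERinf (P : Rbar -> Prop) : Rbar :=
  ERsup (fun v => forall w, P w -> Rbar_le v w).

Fixpoint ERpsum (a : nat -> Rbar) (n : nat) : Rbar :=
  match n with
  | O => Fin 0
  | S k => Rbar_plus (ERpsum a k) (a k)
  end.

Definition ERsum (a : nat -> Rbar) : Rbar :=
  ERsup (fun v => exists n, v = ERpsum a n).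

Definition diam (U : R -> Prop) : Rbar :=
  ERsup (fun v => exists a b, U a /\ U b /\ v = Fin (Rabs (a - b))).

(** contribution f(diam U) of a covering set; sets of diameter 0 (or empty)
    contribute 0 = lim_{t->0} f(t) *)
Definition hcontrib (f : R -> R) (U : R -> Prop) : Rbar :=
  match diam U with
  | Fin r => if Rlt_dec 0 r then Fin (f r) else Fin 0
  | PInf => PInf
  | MInf => Fin 0
  end.

Definition Hcontent (f : R -> R) (eta : R) (S : R -> Prop) : Rbar :=
  ERinf (fun v => exists U : nat -> R -> Prop,
           (forall x, S x -> exists i, U i x) /\
           (forall i, Rbar_le (diam (U i)) (Fin eta)) /\
           v = ERsum (fun i => hcontrib f (U i))).

Definition Hmeas (f : R -> R) (S : R -> Prop) : Rbar :=
  ERsup (fun v => exists eta, 0 < eta /\ v = Hcontent f eta S).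

Definition dimH (S : R -> Prop) : Rbar :=
  ERinf (fun v => exists s, 0 <= s /\ Hmeas (fun t => Rpower t s) S = Fin 0
                           /\ v = Fin s).

Definition dimension_function (f : R -> R) : Prop :=
  (forall s t, 0 < s -> s <= t -> f s <= f t) /\
  (forall t, 0 < t -> 0 < f t) /\
  (forall t, 0 < t -> continuity_pt f t) /\
  (forall eps, 0 < eps -> exists del, 0 < del /\
       forall t, 0 < t < del -> f t < eps).

Definition Jset (d : nat) (E : list nat) (x : R) : Prop :=
  exists a : nat -> nat, (forall i, In (a i) E) /\
    infinite_sum (fun i => INR (a i) / INR d ^ (S i)) x.

Definition translate (S : R -> Prop) (x : R) : R -> Prop := fun t => S (t + x).

(** y is intrinsically approximable w.r.t. psi in S: infinitely many
    rationals p/q in S, in lowest terms (q >= 1, gcd(p,q)=1), with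
    |y - p/q| <= psi(q)/q. "Infinitely many" = not contained in any finite list. *)
Definition int_approx (S : R -> Prop) (psi : nat -> R) (y : R) : Prop :=
  forall l : list (Z * nat), exists (p : Z) (q : nat),
    ~ In (p, q) l /\ (1 <= q)%nat /\ Z.gcd p (Z.of_nat q) = 1%Z /\
    S (IZR p / INR q) /\
    Rabs (y - IZR p / INR q) <= psi q / INR q.

Definition badly_int_approx (S : R -> Prop) (psi : nat -> R) (y : R) : Prop :=
  S y /\ exists eps, 0 < eps /\ ~ int_approx S (fun q => eps * psi q) y.

Definition WA_int (S : R -> Prop) (psi : nat -> R) : R -> Prop :=
  fun y => S y /\ ~ badly_int_approx S psi y.

(* Main.v *)
Require Import Defs.
From Stdlib Require Import Reals Lra Lia ZArith Znumtheory List Cantor.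
From Stdlib Require Import Classical ClassicalEpsilon Zpow_facts.
Open Scope R_scope.

(** Write k = #E, so that d^delta = k, and code the points of J by digit sequences.

    If x and x + r both lie in J with r rational but not d-adic, the gap condition makes the digits
    of x + r a function of those of x, and within a bounded number of steps some digit of x is
    forbidden; hence the set of such x is H^delta-null. For the other x, the rationals of J_x with
    denominator d^n come from replacing the first n digits of x by another word, and since d is
    prime the denominator is exactly d^n when the n-th digit changes. So y + x is well approximated
    when, for infinitely many n, its expansion differs from x at the place n and then agrees with x
    on a block of prescribed length.

    Convergence is the covering argument. For divergence, the mismatch at the place n makes two such
    events either disjoint or independent. If f(t) = O(t^delta), the probability of avoiding all of
    them is bounded by a product tending to 0, so the complement is null. Otherwise t^-delta f(t)
    tends to infinity and H^f of the limsup set is infinite: given cylinders of finite total f-cost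
    and small size, one descends the digit tree greedily, comparing the cost still inside a cylinder
    with a mass carried by the targets, and reaches a point of the limsup set outside all of them.
    The same statement for f(t) = t^s identifies delta. *)

(** * Finite sums *)

(** The exceptional set has to be fixed before psi and f are given, so it may depend on rationals
    only. The number of steps before a forbidden digit is bounded because a fixed q remains a
    denominator of every later difference: such a difference, not being 0, is at least 1/q in
    absolute value, and multiplication by d soon pushes it out of (-1,1). Well approximable means
    approximable for every eps * psi. For convergence eps = 1/2 suffices. For divergence all eps =
    1/(s+1) are needed, and one has to see that shrinking psi keeps the sums divergent; this uses
    f(t) = O(t^delta) in one case and f(ct) <= c^delta f(t) for c >= 1 in the other. When t^-delta
    f(t) is unbounded, the mass on the targets weighs a target of length j by f(d^-j). A cylinder of
    length j then carries at most twice f(d^-j): one share from targets not yet begun, one from the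
    single target that may be in progress. The factor 2 lost at each target is regained by first
    descending so deep that t^-delta f(t) has doubled. *)

Definition lsum {A : Type} (phi : A -> R) (l : list A) : R :=
  fold_right (fun a s => phi a + s) 0 l.

Lemma lsum_app {A} (phi : A -> R) l l' : lsum phi (l ++ l') = lsum phi l + lsum phi l'.
Proof. induction l as [|a l IH]; simpl; [lra | rewrite IH; lra]. Qed.

Lemma lsum_le {A} (phi phi' : A -> R) l :
  (forall a, In a l -> phi a <= phi' a) -> lsum phi l <= lsum phi' l.
Proof.
induction l as [|a l IH]; simpl; intros H; [lra|].
apply Rplus_le_compat; [apply H; now left | apply IH; intros; apply H; now right].
Qed.

Lemma lsum_ext {A} (phi phi' : A -> R) l :
  (forall a, In a l -> phi a = phi' a) -> lsum phi l = lsum phi' l.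
Proof. intros H; apply Rle_antisym; apply lsum_le; intros a Ha; rewrite H; auto; lra. Qed.

Lemma lsum_nonneg {A} (phi : A -> R) l : (forall a, In a l -> 0 <= phi a) -> 0 <= lsum phi l.
Proof.
induction l as [|a l IH]; simpl; intros H; [lra|].
apply Rplus_le_le_0_compat; [apply H; now left | apply IH; intros; apply H; now right].
Qed.

Lemma lsum_scal {A} (c : R) (phi : A -> R) l : lsum (fun a => c * phi a) l = c * lsum phi l.
Proof. induction l as [|a l IH]; simpl; [lra | rewrite IH; lra]. Qed.

Lemma lsum_plus {A} (phi phi' : A -> R) l :
  lsum (fun a => phi a + phi' a) l = lsum phi l + lsum phi' l.
Proof. induction l as [|a l IH]; simpl; [lra | rewrite IH; lra]. Qed.

Lemma lsum_const {A} (c : R) (l : list A) : lsum (fun _ => c) l = c * INR (length l).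
Proof.
induction l as [|a l IH]; [simpl; lra|].
change (length (a :: l)) with (S (length l)). rewrite S_INR; simpl; rewrite IH; lra.
Qed.

Lemma lsum_exchange {A B} (phi : A -> B -> R) l l' :
  lsum (fun a => lsum (phi a) l') l = lsum (fun b => lsum (fun a => phi a b) l) l'.
Proof.
induction l as [|a l IH]; simpl; [rewrite lsum_const; lra | rewrite IH, lsum_plus; lra].
Qed.

Lemma lsum_map {A B} (phi : B -> R) (h : A -> B) l :
  lsum phi (map h l) = lsum (fun a => phi (h a)) l.
Proof. induction l as [|a l IH]; simpl; [lra | rewrite IH; lra]. Qed.

Lemma lsum_flat_map {A B} (phi : B -> R) (h : A -> list B) l :
  lsum phi (flat_map h l) = lsum (fun a => lsum phi (h a)) l.
Proof. induction l as [|a l IH]; simpl; [lra | rewrite lsum_app, IH; lra]. Qed.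

Lemma lsum_incl {A} (phi : A -> R) l l' : (forall a, 0 <= phi a) ->
  NoDup l -> incl l l' -> lsum phi l <= lsum phi l'.
Proof.
intros Hp Hl; revert l'; induction Hl as [|a l Ha Hl IH]; intros l' Hi; simpl.
- apply lsum_nonneg; auto.
- destruct (in_split a l' (Hi a (or_introl eq_refl))) as [l1 [l2 ->]].
  rewrite lsum_app; simpl.
  enough (lsum phi l <= lsum phi (l1 ++ l2)) by (rewrite lsum_app in H; lra).
  apply IH. intros b Hb.
  assert (Hb' := Hi b (or_intror Hb)). apply in_app_or in Hb'.
  apply in_or_app; destruct Hb' as [|[->|]]; auto. contradiction.
Qed.

(** For sums over mutually exclusive alternatives: at most one summand is positive, so no factor for
    the number of terms appears. *)
Lemma lsum_unique {A} (phi : A -> R) l b : 0 <= b -> NoDup l ->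
  (forall a, In a l -> phi a <= b) ->
  (forall a a', In a l -> In a' l -> a <> a' -> 0 < phi a -> phi a' <= 0) ->
  lsum phi l <= b.
Proof.
intros Hb Hl; revert b Hb; induction Hl as [|a l Ha Hl IH]; intros b Hb Hle Hu; simpl; [lra|].
destruct (Rlt_dec 0 (phi a)) as [Hp|Hn].
- assert (lsum phi l <= 0).
  { rewrite <- (Rmult_0_l (INR (length l))), <- lsum_const.
    apply lsum_le; intros c Hc. apply (Hu a c); simpl; auto. intros ->; contradiction. }
  specialize (Hle a (or_introl eq_refl)); lra.
- enough (lsum phi l <= b) by lra.
  apply IH; auto; intros; [apply Hle | apply (Hu a0)]; simpl; auto.
Qed.

Lemma lsum_lt_ex {A} (phi phi' : A -> R) l :
  lsum phi l < lsum phi' l -> exists a, In a l /\ phi a < phi' a.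
Proof.
intros H. apply NNPP; intros Hn. apply (Rlt_not_le _ _ H), lsum_le.
intros a Ha. apply Rnot_lt_le; intros Hl; apply Hn; now exists a.
Qed.

Lemma lsum_seq_S (phi : nat -> R) n m : lsum phi (seq n (S m)) = lsum phi (seq n m) + phi (n + m)%nat.
Proof. rewrite seq_S, lsum_app; simpl; lra. Qed.

Lemma lsum_seq_mono (phi : nat -> R) s n m : (forall i, 0 <= phi i) -> (n <= m)%nat ->
  lsum phi (seq s n) <= lsum phi (seq s m).
Proof.
intros H Hnm. apply lsum_incl; auto using seq_NoDup.
intros i; rewrite !in_seq; lia.
Qed.

Lemma sum_f_R0_lsum (u : nat -> R) n : sum_f_R0 u n = lsum u (seq 0 (S n)).
Proof. induction n as [|n IH]; [simpl; lra|]. rewrite lsum_seq_S, <- IH; reflexivity. Qed.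

Lemma bounded_sums_converge (u : nat -> R) b : (forall i, 0 <= u i) ->
  (forall n, lsum u (seq 0 n) <= b) -> exists l, infinite_sum u l.
Proof.
intros Hu Hb. destruct (growing_cv (sum_f_R0 u)) as [l Hl].
- intros n; simpl; specialize (Hu (S n)); lra.
- exists b. intros v [n ->]. rewrite sum_f_R0_lsum; apply Hb.
- exists l; exact Hl.
Qed.

Lemma infinite_sum_bounds (u : nat -> R) l : (forall i, 0 <= u i) -> infinite_sum u l ->
  forall n, lsum u (seq 0 n) <= l.
Proof.
intros Hu Hl n. destruct n as [|n].
- apply Rle_trans with (sum_f_R0 u 0); [apply Hu|].
  apply (growing_ineq (sum_f_R0 u) l); [intros m; simpl; specialize (Hu (S m)); lra | exact Hl].
- rewrite <- sum_f_R0_lsum.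
  apply (growing_ineq (sum_f_R0 u) l); [intros m; simpl; specialize (Hu (S m)); lra | exact Hl].
Qed.

Lemma infinite_sum_tail (u : nat -> R) l eps : (forall i, 0 <= u i) -> infinite_sum u l ->
  0 < eps -> exists n0, forall n m, (n0 <= n)%nat -> lsum u (seq n m) <= eps.
Proof.
intros Hu Hl He. destruct (Hl eps He) as [N HN]. exists (S N). intros n m Hn.
assert (HB := infinite_sum_bounds u l Hu Hl (n + m)).
rewrite seq_app, lsum_app in HB; simpl in HB.
assert (HS := lsum_seq_mono u 0 (S N) n Hu Hn). rewrite <- sum_f_R0_lsum in HS.
specialize (HN N (le_n N)). unfold Rdist in HN. apply Rabs_def2 in HN. lra.
Qed.

Lemma Un_cv_lsum {A} (u : nat -> A -> R) (v : A -> R) l :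
  (forall a, In a l -> Un_cv (fun n => u n a) (v a)) ->
  Un_cv (fun n => lsum (u n) l) (lsum v l).
Proof.
induction l as [|a l IH]; simpl; intros H.
- intros eps He; exists O; intros; unfold Rdist; rewrite Rminus_diag, Rabs_R0; auto.
- apply CV_plus; auto.
Qed.

Lemma Un_cv_le (u : nat -> R) l b : Un_cv u l -> (forall n, u n <= b) -> l <= b.
Proof.
intros Hc Hb. apply Rnot_lt_le; intros Hl.
destruct (Hc (l - b)) as [N HN]; [lra|].
specialize (HN N (le_n N)); specialize (Hb N). unfold Rdist in HN; apply Rabs_def2 in HN; lra.
Qed.

(** Bounded partial sums force [h] to tend to 0, so [c0 <= h m] fails from some index on and the
    comparison with [c * h m] takes over. The first alternative absorbs the indices where the block
    length is 0 or the approximation radius is large. *)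
Lemma sum_comparison (h t : nat -> R) c0 c b : 0 < c0 -> 0 <= c ->
  (forall m, 0 <= h m) -> (forall m, c0 <= h m \/ t m <= c * h m) ->
  (forall n, lsum h (seq 0 n) <= b) -> exists b', forall n, lsum t (seq 0 n) <= b'.
Proof.
intros Hc0 Hc Hh Hor Hb.
destruct (bounded_sums_converge h b Hh Hb) as [l Hl].
destruct (infinite_sum_tail h l (c0 / 2) Hh Hl) as [n0 Hn0]; [lra|].
assert (Ht : forall m, (n0 <= m)%nat -> t m <= c * h m).
{ intros m Hm. destruct (Hor m) as [H|H]; auto.
  specialize (Hn0 m 1%nat Hm); simpl in Hn0; lra. }
exists (lsum (fun m => Rabs (t m)) (seq 0 n0) + c * b). intros n.
assert (HA : forall j, lsum t (seq 0 j) <= lsum (fun m => Rabs (t m)) (seq 0 j))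
  by (intros; apply lsum_le; intros; apply Rle_abs).
assert (HP : forall j, 0 <= Rabs (t j)) by (intros; apply Rabs_pos).
destruct (le_lt_dec n n0) as [Hn|Hn].
- apply Rle_trans with (lsum (fun m => Rabs (t m)) (seq 0 n0)).
  + apply Rle_trans with (1 := HA n). apply lsum_seq_mono; auto.
  + specialize (Hb 0%nat); simpl in Hb. assert (0 <= c * b) by nra. lra.
- replace n with (n0 + (n - n0))%nat by lia. rewrite seq_app, lsum_app; simpl.
  apply Rplus_le_compat; [apply HA|].
  apply Rle_trans with (lsum (fun m => c * h m) (seq n0 (n - n0))).
  + apply lsum_le. intros m; rewrite in_seq; intros; apply Ht; lia.
  + rewrite lsum_scal. apply Rmult_le_compat_l; auto.
    apply Rle_trans with (2 := Hb n).
    apply lsum_incl; auto using seq_NoDup. intros i; rewrite !in_seq; lia.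
Qed.

(** * Hausdorff measure through interval covers *)

Lemma Rbar_le_refl a : Rbar_le a a.
Proof. destruct a; simpl; auto; lra. Qed.

Lemma Rbar_le_trans a b c : Rbar_le a b -> Rbar_le b c -> Rbar_le a c.
Proof. destruct a, b, c; simpl; auto; try lra; tauto. Qed.

Lemma Rbar_le_antisym a b : Rbar_le a b -> Rbar_le b a -> a = b.
Proof. destruct a, b; simpl; auto; try tauto. intros; f_equal; lra. Qed.

Lemma ERsup_ub (P : Rbar -> Prop) v : P v -> Rbar_le v (ERsup P).
Proof. apply (proj2_sig (constructive_indefinite_description _ (ERlub_ex P))). Qed.

Lemma ERsup_least (P : Rbar -> Prop) u : (forall v, P v -> Rbar_le v u) -> Rbar_le (ERsup P) u.
Proof. apply (proj2_sig (constructive_indefinite_description _ (ERlub_ex P))). Qed.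

Lemma ERinf_lb (P : Rbar -> Prop) v : P v -> Rbar_le (ERinf P) v.
Proof. intros H; apply ERsup_least; auto. Qed.

Lemma ERinf_greatest (P : Rbar -> Prop) u : (forall v, P v -> Rbar_le u v) -> Rbar_le u (ERinf P).
Proof. intros H; apply ERsup_ub; auto. Qed.

Lemma ERinf_approx (P : Rbar -> Prop) b eps : 0 < eps ->
  Rbar_le (ERinf P) (Fin b) -> exists v, P v /\ Rbar_le v (Fin (b + eps)).
Proof.
intros He Hb. apply NNPP; intros Hn.
enough (H : Rbar_le (Fin (b + eps)) (Fin b)) by (simpl in H; lra).
apply Rbar_le_trans with (2 := Hb), ERinf_greatest. intros v Hv.
destruct v as [v| |]; simpl; auto.
- apply Rnot_lt_le; intros Hl. apply Hn; exists (Fin v); simpl; split; auto; lra.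
- apply Hn; exists MInf; simpl; auto.
Qed.

(* A degenerate interval costs nothing, so that it can pad a finite cover. *)
Definition fcost (f : R -> R) (l : R) : R := if Rlt_dec 0 l then f l else 0.

Lemma fcost_0 f : fcost f 0 = 0.
Proof. unfold fcost; destruct (Rlt_dec 0 0); lra. Qed.

Lemma fcost_pos f l : 0 < l -> fcost f l = f l.
Proof. unfold fcost; destruct (Rlt_dec 0 l); lra. Qed.

Definition nonneg_gauge (f : R -> R) : Prop := forall t, 0 < t -> 0 <= f t.

Lemma fcost_nonneg f l : nonneg_gauge f -> 0 <= fcost f l.
Proof. intros Hf; unfold fcost; destruct (Rlt_dec 0 l); [apply Hf; auto | lra]. Qed.

Definition interval_cover (f : R -> R) (eta : R) (S : R -> Prop) (b : R) : Prop :=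
  exists I : nat -> R * R,
    (forall i, 0 <= snd (I i) <= eta) /\
    (forall x, S x -> exists i, fst (I i) <= x <= fst (I i) + snd (I i)) /\
    (forall n, lsum (fun i => fcost f (snd (I i))) (seq 0 n) <= b).

(** [Hmeas f S <= b] freed of extended reals: the slack [eps] stands for the infimum over covers,
    the arbitrary [eta] for the supremum over scales. All measure estimates are made in this
    form. *)
Definition Hbound (f : R -> R) (S : R -> Prop) (b : R) : Prop :=
  forall eps eta, 0 < eps -> 0 < eta -> interval_cover f eta S (b + eps).

Lemma diam_interval a l : 0 <= l -> diam (fun x => a <= x <= a + l) = Fin l.
Proof.
intros Hl. apply Rbar_le_antisym.
- apply ERsup_least. intros v [x [y [Hx [Hy ->]]]]; simpl.
  apply Rabs_le; lra.
- apply ERsup_ub. exists (a + l), a. repeat split; try lra.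
  f_equal. rewrite Rabs_right; lra.
Qed.

Lemma hcontrib_interval f a l : 0 <= l ->
  hcontrib f (fun x => a <= x <= a + l) = Fin (fcost f l).
Proof.
intros Hl. unfold hcontrib, fcost. rewrite diam_interval; auto.
now destruct (Rlt_dec 0 l).
Qed.

Lemma ERpsum_Fin (u : nat -> R) n : ERpsum (fun i => Fin (u i)) n = Fin (lsum u (seq 0 n)).
Proof. induction n as [|n IH]; [reflexivity|]. rewrite lsum_seq_S; simpl; rewrite IH; reflexivity. Qed.

Lemma ERpsum_ext a a' n : (forall i, a i = a' i) -> ERpsum a n = ERpsum a' n.
Proof. intros H; induction n as [|n IH]; simpl; auto. now rewrite IH, H. Qed.

Lemma ERsum_nonneg a : Rbar_le (Fin 0) (ERsum a).
Proof. apply ERsup_ub; now exists O. Qed.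

Lemma Hmeas_nonneg f S : Rbar_le (Fin 0) (Hmeas f S).
Proof.
apply Rbar_le_trans with (Hcontent f 1 S).
- apply ERinf_greatest. intros v [U [_ [_ ->]]]. apply ERsum_nonneg.
- apply ERsup_ub. exists 1; split; [lra | auto].
Qed.

(** The interval ends at the supremum of [U] and has the diameter of [U] as its length, so passing
    from arbitrary sets to intervals costs nothing. The empty set gets a degenerate interval. *)
Lemma enclosing_interval f U eta : Rbar_le (diam U) (Fin eta) -> 0 < eta ->
  exists I : R * R, 0 <= snd I <= eta /\ (forall x, U x -> fst I <= x <= fst I + snd I) /\
    hcontrib f U = Fin (fcost f (snd I)).
Proof.
intros Hd He.
destruct (classic (exists x, U x)) as [[x0 Hx0]|Hn].
- destruct (diam U) as [r| |] eqn:E; simpl in Hd; try contradiction.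
  + assert (Hr : forall x y, U x -> U y -> Rabs (x - y) <= r).
    { intros x y Hx Hy. enough (H : Rbar_le (Fin (Rabs (x - y))) (diam U)) by (rewrite E in H; auto).
      apply ERsup_ub; now exists x, y. }
    assert (0 <= r) by (apply Rle_trans with (2 := Hr x0 x0 Hx0 Hx0), Rabs_pos).
    destruct (completeness U) as [s [Hs1 Hs2]].
    { exists (x0 + r). intros x Hx. assert (Hh := Hr x x0 Hx Hx0).
      assert (Hh' := Rle_abs (x - x0)); lra. }
    { now exists x0. }
    exists (s - r, r); simpl; repeat split; auto.
    * enough (s <= x + r) by lra. apply Hs2. intros y Hy.
      assert (Hh := Hr y x Hy H0). assert (Hh' := Rle_abs (y - x)); lra.
    * assert (Hh := Hs1 x H0); lra.
    * unfold hcontrib, fcost; rewrite E; now destruct (Rlt_dec 0 r).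
  + exfalso. enough (H : Rbar_le (Fin 0) (diam U)) by (rewrite E in H; auto).
    apply ERsup_ub; exists x0, x0; repeat split; auto. now rewrite Rminus_diag, Rabs_R0.
- exists (0, 0); simpl. repeat split; try lra.
  + exfalso; apply Hn; now exists x.
  + exfalso; apply Hn; now exists x.
  + rewrite fcost_0. unfold hcontrib. replace (diam U) with MInf; auto.
    apply Rbar_le_antisym; simpl; auto. apply ERsup_least.
    intros v [a [b [Ha _]]]; exfalso; apply Hn; now exists a.
Qed.

Lemma Hmeas_le_iff f S b : Rbar_le (Hmeas f S) (Fin b) <-> Hbound f S b.
Proof.
split.
- intros H eps eta He Heta.
  assert (Hc : Rbar_le (Hcontent f eta S) (Fin b)).
  { apply Rbar_le_trans with (2 := H), ERsup_ub. now exists eta. }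
  destruct (ERinf_approx _ _ eps He Hc) as [v [[U [HU1 [HU2 ->]]] Hv]].
  destruct (choice (fun i (I : R * R) => 0 <= snd I <= eta /\
     (forall x, U i x -> fst I <= x <= fst I + snd I) /\ hcontrib f (U i) = Fin (fcost f (snd I))))
    as [I HI].
  { intros i; apply enclosing_interval; auto. }
  exists I. split; [|split].
  + intros i; apply HI.
  + intros x Hx. destruct (HU1 x Hx) as [i Hi]. exists i. now apply HI.
  + intros n. enough (Hn : Rbar_le (Fin (lsum (fun i => fcost f (snd (I i))) (seq 0 n))) (Fin (b + eps)))
      by exact Hn.
    apply Rbar_le_trans with (2 := Hv), ERsup_ub. exists n.
    rewrite <- ERpsum_Fin. apply ERpsum_ext. intros i; symmetry; apply HI.
- intros H. apply ERsup_least. intros v [eta [Heta ->]].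
  assert (Hc : forall eps, 0 < eps -> Rbar_le (Hcontent f eta S) (Fin (b + eps))).
  { intros eps He. destruct (H eps eta He Heta) as [I [HI1 [HI2 HI3]]].
    apply Rbar_le_trans with (ERsum (fun i => hcontrib f (fun x => fst (I i) <= x <= fst (I i) + snd (I i)))).
    - apply ERinf_lb. exists (fun i x => fst (I i) <= x <= fst (I i) + snd (I i)).
      repeat split; auto. intros i. rewrite diam_interval; simpl; apply HI1.
    - apply ERsup_least. intros v [n ->].
      rewrite (ERpsum_ext _ (fun i => Fin (fcost f (snd (I i))))).
      + rewrite ERpsum_Fin; simpl; apply HI3.
      + intros i; apply hcontrib_interval, HI1. }
  destruct (Hcontent f eta S) as [r| |]; simpl in *; auto.
  + apply le_epsilon; auto.
  + apply (Hc 1); lra.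
Qed.

Lemma Hmeas_null f S : Hbound f S 0 -> Hmeas f S = Fin 0.
Proof. intros H; apply Rbar_le_antisym; [now apply Hmeas_le_iff | apply Hmeas_nonneg]. Qed.

Lemma Hmeas_le_of_bounds f g S T : (forall b, Hbound g T b -> Hbound f S b) ->
  Rbar_le (Hmeas f S) (Hmeas g T).
Proof.
intros H. destruct (Hmeas g T) as [b| |] eqn:E.
- apply Hmeas_le_iff, H, Hmeas_le_iff. rewrite E; apply Rbar_le_refl.
- destruct (Hmeas f S); simpl; auto.
- assert (Hn := Hmeas_nonneg g T). rewrite E in Hn; contradiction.
Qed.

Lemma Hmeas_infinite f S : (forall b, ~ Hbound f S b) -> Hmeas f S = PInf.
Proof.
intros H. destruct (Hmeas f S) as [b| |] eqn:E; auto.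
- exfalso; apply (H b), Hmeas_le_iff. rewrite E; apply Rbar_le_refl.
- assert (Hn := Hmeas_nonneg f S). rewrite E in Hn; contradiction.
Qed.

Lemma Hbound_translate f S T x b : (forall y, S y -> T (y - x)) -> Hbound f T b -> Hbound f S b.
Proof.
intros Hs H eps eta He Heta. destruct (H eps eta He Heta) as [I [H1 [H2 H3]]].
exists (fun i => (fst (I i) + x, snd (I i))); simpl. split; [|split]; auto.
intros y Hy. destruct (H2 _ (Hs y Hy)) as [i Hi]. exists i; lra.
Qed.

(** Only small scales matter: covers are taken with mesh at most [Rmin eta 1]. *)
Lemma Hbound_gauge f g S b : (forall t, 0 < t <= 1 -> f t <= g t) -> Hbound g S b -> Hbound f S b.
Proof.
intros Hfg H eps eta He Heta.
destruct (H eps (Rmin eta 1)) as [I [H1 [H2 H3]]]; auto.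
{ apply Rmin_glb_lt; lra. }
assert (Hm1 := Rmin_l eta 1). assert (Hm2 := Rmin_r eta 1).
exists I; split; [|split]; auto.
- intros i; specialize (H1 i); lra.
- intros n. apply Rle_trans with (2 := H3 n). apply lsum_le. intros i _.
  unfold fcost. destruct (Rlt_dec 0 (snd (I i))); [|lra].
  apply Hfg. specialize (H1 i); lra.
Qed.

(** Cantor pairing makes the double family a sequence. Since p + q never exceeds the code of (p, q),
    the first n codes decode into the square of side n, so bounds on finite rectangles are
    enough. *)
Lemma interval_cover_double f eta S b (I : nat -> nat -> R * R) : nonneg_gauge f ->
  (forall n i, 0 <= snd (I n i) <= eta) ->
  (forall x, S x -> exists n i, fst (I n i) <= x <= fst (I n i) + snd (I n i)) ->
  (forall n m, lsum (fun j => lsum (fun i => fcost f (snd (I j i))) (seq 0 m)) (seq 0 n) <= b) ->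
  interval_cover f eta S b.
Proof.
intros Hf H1 H2 H3.
exists (fun i => I (fst (of_nat i)) (snd (of_nat i))). split; [|split]; auto.
- intros x Hx. destruct (H2 x Hx) as [n [i Hi]]. exists (to_nat (n, i)).
  rewrite cancel_of_to; exact Hi.
- intros n. apply Rle_trans with (2 := H3 n n).
  set (c := fun p : nat * nat => fcost f (snd (I (fst p) (snd p)))).
  apply Rle_trans with (lsum c (map of_nat (seq 0 n))).
  { rewrite lsum_map; apply Rle_refl. }
  apply Rle_trans with (lsum c (list_prod (seq 0 n) (seq 0 n))).
  + apply lsum_incl.
    * intros; apply fcost_nonneg; auto.
    * apply NoDup_map_NoDup_ForallPairs; auto using seq_NoDup.
      intros i j _ _ Hij. now rewrite <- (cancel_to_of i), <- (cancel_to_of j), Hij.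
    * intros [p q] Hin. apply in_map_iff in Hin as [i [Hi Hin]].
      apply in_seq in Hin. assert (Hle := to_nat_non_decreasing p q).
      rewrite <- Hi, cancel_to_of in Hle.
      apply in_prod; apply in_seq; lia.
  + apply Req_le. generalize (seq 0 n) at 1 4; intros l.
    induction l as [|a l IH]; auto.
    change (list_prod (a :: l) (seq 0 n)) with (map (fun y => (a, y)) (seq 0 n) ++ list_prod l (seq 0 n)).
    rewrite lsum_app, lsum_map, IH. reflexivity.
Qed.

Lemma Hbound_union f (Q : R -> Prop) (T : nat -> R -> Prop) : nonneg_gauge f ->
  (forall x, Q x -> exists n, T n x) -> (forall n, Hbound f (T n) 0) -> Hbound f Q 0.
Proof.
intros Hf HS HT eps eta He Heta.
destruct (choice (fun n (I : nat -> R * R) => (forall i, 0 <= snd (I i) <= eta) /\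
  (forall x, T n x -> exists i, fst (I i) <= x <= fst (I i) + snd (I i)) /\
  (forall m, lsum (fun i => fcost f (snd (I i))) (seq 0 m) <= eps * (/ 2) ^ S n))) as [I HI].
{ intros n. assert (Hp : 0 < eps * (/ 2) ^ S n) by (apply Rmult_lt_0_compat; auto; apply pow_lt; lra).
  destruct (HT n _ eta Hp Heta) as [I HI]. exists I. rewrite Rplus_0_l in HI; exact HI. }
apply (interval_cover_double f eta Q (0 + eps) I); auto.
- intros n i; apply HI.
- intros x Hx. destruct (HS x Hx) as [n Hn]. exists n. now apply HI.
- intros n m. apply Rle_trans with (eps * (1 - (/ 2) ^ n)).
  + induction n as [|n IH]; [simpl; lra|].
    rewrite lsum_seq_S. apply Rle_trans with (eps * (1 - (/ 2) ^ n) + eps * (/ 2) ^ S n).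
    * apply Rplus_le_compat; auto. apply HI.
    * simpl; lra.
  + assert (0 < (/ 2) ^ n) by (apply pow_lt; lra). nra.
Qed.

Lemma Hbound_split f (Q T V : R -> Prop) b : nonneg_gauge f ->
  (forall x, Q x -> T x \/ V x) -> Hbound f T b -> Hbound f V 0 -> Hbound f Q b.
Proof.
intros Hf HS HT HV eps eta He Heta.
destruct (HT (eps / 2) eta) as [I [I1 [I2 I3]]]; auto; [lra|].
destruct (HV (eps / 2) eta) as [J [J1 [J2 J3]]]; auto; [lra|].
apply (interval_cover_double f eta Q _
  (fun n i => match n with O => I i | 1%nat => J i | _ => (0, 0) end)); auto.
- intros [|[|n]] i; auto; simpl; lra.
- intros x Hx. destruct (HS x Hx) as [H|H].
  + exists O; auto.
  + exists 1%nat; auto.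
- intros n m.
  assert (HB : forall n', lsum (fun j => lsum (fun i => fcost f (snd
     (match j with O => I i | 1%nat => J i | _ => (0, 0) end))) (seq 0 m)) (seq 0 (2 + n'))
     <= b + eps).
  { induction n' as [|n' IH].
    - simpl. specialize (I3 m); specialize (J3 m). lra.
    - rewrite Nat.add_succ_r, lsum_seq_S. simpl (0 + (2 + n'))%nat.
      cbv beta iota. simpl snd. rewrite lsum_const, fcost_0. lra. }
  apply Rle_trans with (2 := HB n). apply lsum_seq_mono; [|lia].
  intros i. apply lsum_nonneg. intros; apply fcost_nonneg; auto.
Qed.

(** Each list is padded to a sequence by the interval [(0, 0)], which has cost 0. *)
Lemma interval_cover_lists f eta (S : R -> Prop) b (L : nat -> list (R * R)) : nonneg_gauge f -> 0 < eta ->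
  (forall n p, In p (L n) -> 0 <= snd p <= eta) ->
  (forall x, S x -> exists n p, In p (L n) /\ fst p <= x <= fst p + snd p) ->
  (forall n, lsum (fun j => lsum (fun p => fcost f (snd p)) (L j)) (seq 0 n) <= b) ->
  interval_cover f eta S b.
Proof.
intros Hf He H1 H2 H3.
apply (interval_cover_double f eta S b (fun n i => nth i (L n) (0, 0))); auto.
- intros n i. destruct (nth_in_or_default i (L n) (0, 0)) as [H|H].
  + now apply (H1 n).
  + rewrite H; simpl; lra.
- intros x Hx. destruct (H2 x Hx) as [n [p [Hp Hi]]].
  destruct (In_nth _ _ (0, 0) Hp) as [i [_ Hn]]. exists n, i. now rewrite Hn.
- intros n m. apply Rle_trans with (2 := H3 n). apply lsum_le. intros j _.
  generalize (L j); intros l. revert m; induction l as [|p l IH]; intros m.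
  + apply Req_le. transitivity (lsum (fun _ : nat => 0) (seq 0 m)).
    * apply lsum_ext. intros [|i] _; apply fcost_0.
    * rewrite lsum_const; simpl; lra.
  + destruct m as [|m].
    * apply lsum_nonneg; intros; apply fcost_nonneg; auto.
    * simpl. rewrite <- seq_shift, lsum_map. specialize (IH m). simpl in IH. lra.
Qed.

(** * Digit expansions *)

Definition isval (d : nat) (y : nat -> nat) (v : R) : Prop :=
  infinite_sum (fun i => INR (y i) / INR d ^ S i) v.

Definition digits (E : list nat) (y : nat -> nat) : Prop := forall i, In (y i) E.

Definition shift (n : nat) (y : nat -> nat) : nat -> nat := fun i => y (n + i)%nat.

Definition splice (y x : nat -> nat) (n : nat) : nat -> nat :=
  fun i => if Nat.ltb i n then y i else x i.

Definition trunc (d : nat) (y : nat -> nat) (n : nat) : R :=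
  lsum (fun i => INR (y i) / INR d ^ S i) (seq 0 n).

(** The integer d^n * [trunc d y n], kept in Z for the divisibility arguments. *)
Fixpoint numer (d : nat) (y : nat -> nat) (n : nat) : Z :=
  match n with
  | O => 0%Z
  | S m => (Z.of_nat d * numer d y m + Z.of_nat (y m))%Z
  end.

Lemma pow_lt_dim (d : nat) n : (2 <= d)%nat -> 0 < INR d ^ n.
Proof. intros Hd; apply pow_lt, lt_0_INR; lia. Qed.

Lemma trunc_numer d y n : (2 <= d)%nat -> trunc d y n = IZR (numer d y n) / INR d ^ n.
Proof.
intros Hd. assert (Hp : 0 < INR d) by (apply lt_0_INR; lia).
induction n as [|n IH]; unfold trunc in *.
- simpl; lra.
- rewrite lsum_seq_S, IH. simpl numer. rewrite plus_IZR, mult_IZR, <- !INR_IZR_INZ. simpl.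
  assert (0 < INR d ^ n) by now apply pow_lt_dim.
  field; lra.
Qed.

Lemma isval_ext d y z v : (forall i, y i = z i) -> isval d y v -> isval d z v.
Proof.
intros H Hy eps He. destruct (Hy eps He) as [N HN]. exists N. intros n Hn.
rewrite <- (sum_eq (fun i => INR (y i) / INR d ^ S i)); auto.
intros i _. now rewrite H.
Qed.

Lemma isval_tail d y v : (2 <= d)%nat ->
  isval d y v <-> isval d (shift 1 y) (INR d * v - INR (y O)).
Proof.
intros Hd. assert (HD : 2 <= INR d) by (replace 2 with (INR 2) by (simpl; lra); now apply le_INR).
assert (HS : forall n, sum_f_R0 (fun i => INR (y i) / INR d ^ S i) (S n) =
  INR (y O) / INR d + / INR d * sum_f_R0 (fun i => INR (shift 1 y i) / INR d ^ S i) n).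
{ intros n. rewrite decomp_sum by lia. simpl Nat.pred. f_equal.
  - simpl; field; lra.
  - rewrite scal_sum. apply sum_eq. intros i _. unfold shift.
    assert (0 < INR d ^ i) by now apply pow_lt_dim.
    change (1 + i)%nat with (S i). simpl pow. field; split; lra. }
assert (HR : forall n, Rdist (sum_f_R0 (fun i => INR (shift 1 y i) / INR d ^ S i) n) (INR d * v - INR (y O))
   = INR d * Rdist (sum_f_R0 (fun i => INR (y i) / INR d ^ S i) (S n)) v).
{ intros n. unfold Rdist. rewrite HS.
  set (s := sum_f_R0 (fun i => INR (shift 1 y i) / INR d ^ S i) n).
  replace (s - (INR d * v - INR (y O))) with (INR d * (INR (y O) / INR d + / INR d * s - v))
    by (field; lra).
  rewrite Rabs_mult, (Rabs_right (INR d)) by lra. reflexivity. }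
split; intros H eps He.
- destruct (H (eps / INR d)) as [N HN]; [apply Rdiv_lt_0_compat; lra|].
  exists N. intros n Hn. rewrite HR. specialize (HN (S n)).
  apply Rmult_lt_reg_l with (/ INR d); [apply Rinv_0_lt_compat; lra|].
  rewrite <- Rmult_assoc, Rinv_l, Rmult_1_l by lra.
  rewrite Rmult_comm. apply HN; lia.
- destruct (H eps He) as [N HN]. exists (S N). intros [|n] Hn; [lia|].
  specialize (HN n). rewrite HR in HN.
  assert (0 <= Rdist (sum_f_R0 (fun i => INR (y i) / INR d ^ S i) (S n)) v) by apply Rabs_pos.
  assert (INR d * Rdist (sum_f_R0 (fun i => INR (y i) / INR d ^ S i) (S n)) v < eps) by (apply HN; lia).
  nra.
Qed.

Lemma isval_shift d n y v : (2 <= d)%nat ->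
  isval d y v <-> isval d (shift n y) (INR d ^ n * (v - trunc d y n)).
Proof.
intros Hd. assert (Hp : 0 < INR d) by (apply lt_0_INR; lia).
induction n as [|n IH].
- unfold trunc; simpl. replace (1 * (v - 0)) with v by ring. reflexivity.
- rewrite IH, isval_tail by auto.
  assert (He : INR d ^ S n * (v - trunc d y (S n)) =
    INR d * (INR d ^ n * (v - trunc d y n)) - INR (shift n y 0)).
  { unfold trunc. rewrite lsum_seq_S. unfold shift. rewrite Nat.add_0_r. simpl.
    assert (0 < INR d ^ n) by now apply pow_lt_dim. field; split; lra. }
  rewrite He. split; apply isval_ext; intros i; unfold shift; f_equal; lia.
Qed.

(** The source of the approximating rationals: exchanging the first n digits moves the point by a
    rational whose denominator divides d^n. *)
Lemma isval_splice d x y v n : (2 <= d)%nat -> isval d x v ->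
  isval d (splice y x n) (v + trunc d y n - trunc d x n).
Proof.
intros Hd Hx. apply (isval_shift d n); auto.
replace (trunc d (splice y x n) n) with (trunc d y n).
- replace (v + trunc d y n - trunc d x n - trunc d y n) with (v - trunc d x n) by ring.
  apply (isval_ext d (shift n x)); [|now apply isval_shift].
  intros i. unfold shift, splice. now rewrite (proj2 (Nat.ltb_ge _ _)) by lia.
- apply lsum_ext. intros i Hi. apply in_seq in Hi. unfold splice.
  now rewrite (proj2 (Nat.ltb_lt _ _)) by lia.
Qed.

Lemma trunc_ext d y z n : (forall i, (i < n)%nat -> y i = z i) -> trunc d y n = trunc d z n.
Proof. intros H. apply lsum_ext. intros i Hi. apply in_seq in Hi. rewrite H; auto; lia. Qed.

Section Expansions.

Variables (d : nat) (E : list nat).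
Hypothesis (hd : (2 <= d)%nat).
Hypothesis (hE : forall e, In e E -> (e < d)%nat).

Lemma trunc_le y n : digits E y -> trunc d y n <= 1 - / INR d ^ n.
Proof.
intros Hy. assert (Hp : 0 < INR d) by (apply lt_0_INR; lia).
induction n as [|n IH]; unfold trunc in *; [simpl; lra|].
rewrite lsum_seq_S, Nat.add_0_l. change (INR d ^ S n) with (INR d * INR d ^ n).
assert (0 < INR d ^ n) by now apply pow_lt_dim.
assert (INR (y n) <= INR d - 1).
{ specialize (hE _ (Hy n)). rewrite <- (INR_1), <- minus_INR by lia. apply le_INR; lia. }
assert (INR (y n) / (INR d * INR d ^ n) <= (INR d - 1) / (INR d * INR d ^ n)).
{ apply Rmult_le_compat_r; auto. left; apply Rinv_0_lt_compat; nra. }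
replace ((INR d - 1) / (INR d * INR d ^ n)) with (/ INR d ^ n - / (INR d * INR d ^ n)) in H1
  by (field; split; lra).
lra.
Qed.

Lemma digit_term_nonneg (y : nat -> nat) i : 0 <= INR (y i) / INR d ^ S i.
Proof.
assert (0 < INR d ^ S i) by now apply pow_lt_dim.
apply Rmult_le_pos; [apply pos_INR | left; now apply Rinv_0_lt_compat].
Qed.

Lemma isval_ex y : digits E y -> exists v, isval d y v.
Proof.
intros Hy. apply (bounded_sums_converge _ 1); [apply digit_term_nonneg|].
intros n. assert (H := trunc_le y n Hy). unfold trunc in H.
assert (0 < / INR d ^ n) by now apply Rinv_0_lt_compat, pow_lt_dim. lra.
Qed.

Lemma isval_01 y v : digits E y -> isval d y v -> 0 <= v <= 1.
Proof.
intros Hy Hv. split.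
- apply (infinite_sum_bounds _ v (digit_term_nonneg y) Hv 0).
- apply (Un_cv_le _ _ 1 Hv). intros n. rewrite sum_f_R0_lsum.
  assert (H := trunc_le y (S n) Hy). unfold trunc in H.
  assert (0 < / INR d ^ S n) by now apply Rinv_0_lt_compat, pow_lt_dim. lra.
Qed.

Lemma digits_shift y n : digits E y -> digits E (shift n y).
Proof. intros H i; apply H. Qed.

Lemma trunc_approx y v n : digits E y -> isval d y v -> trunc d y n <= v <= trunc d y n + / INR d ^ n.
Proof.
intros Hy Hv. apply (isval_shift d n) in Hv; auto.
apply isval_01 in Hv; [|now apply digits_shift].
assert (0 < INR d ^ n) by now apply pow_lt_dim.
assert (INR d ^ n * / INR d ^ n = 1) by (field; lra). nra.
Qed.

Lemma agree_close y z v w n : digits E y -> digits E z -> isval d y v -> isval d z w ->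
  (forall i, (i < n)%nat -> y i = z i) -> Rabs (v - w) <= / INR d ^ n.
Proof.
intros Hy Hz Hv Hw H.
assert (H1 := trunc_approx y v n Hy Hv). assert (H2 := trunc_approx z w n Hz Hw).
rewrite (trunc_ext d y z n H) in H1. apply Rabs_le; lra.
Qed.

Hypothesis hgap : forall a b, In a E -> In b E -> a <> S b.

(* Distinct digits differ by at least 2, so distinct cylinders of level n are d^-n apart. *)
Lemma close_agree y z v w n : digits E y -> digits E z -> isval d y v -> isval d z w ->
  Rabs (v - w) < / INR d ^ n -> forall i, (i < n)%nat -> y i = z i.
Proof.
assert (Hp : 2 <= INR d) by (replace 2 with (INR 2) by (simpl; lra); now apply le_INR).
revert y z v w; induction n as [|n IH]; intros y z v w Hy Hz Hv Hw H i Hi; [lia|].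
assert (Hpn : 0 < INR d ^ n) by now apply pow_lt_dim.
apply isval_tail in Hv; auto. apply isval_tail in Hw; auto.
assert (Hv1 := isval_01 _ _ (digits_shift y 1 Hy) Hv).
assert (Hw1 := isval_01 _ _ (digits_shift z 1 Hz) Hw).
assert (Hc : Rabs (INR d * v - INR d * w) < / INR d ^ n).
{ rewrite <- Rmult_minus_distr_l, Rabs_mult, Rabs_right by lra.
  apply Rmult_lt_compat_l with (r := INR d) in H; [|lra].
  simpl in H. replace (INR d * / (INR d * INR d ^ n)) with (/ INR d ^ n) in H; auto.
  field; split; lra. }
assert (H0 : y O = z O).
{ assert (/ INR d ^ n <= 1).
  { rewrite <- Rinv_1. apply Rinv_le_contravar; [lra|]. apply pow_R1_Rle; lra. }
  apply Rabs_def2 in Hc.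
  assert (Hg1 := hgap _ _ (Hy O) (Hz O)). assert (Hg2 := hgap _ _ (Hz O) (Hy O)).
  destruct (lt_eq_lt_dec (y O) (z O)) as [[Hl|He]|Hl]; auto; exfalso.
  - assert (Hl2 : (y O + 2 <= z O)%nat) by lia. apply le_INR in Hl2. rewrite plus_INR in Hl2.
    simpl in Hl2. lra.
  - assert (Hl2 : (z O + 2 <= y O)%nat) by lia. apply le_INR in Hl2. rewrite plus_INR in Hl2.
    simpl in Hl2. lra. }
destruct i as [|i]; auto.
change (y (S i)) with (shift 1 y i); change (z (S i)) with (shift 1 z i).
apply (IH _ _ _ _ (digits_shift y 1 Hy) (digits_shift z 1 Hz) Hv Hw); [|lia].
rewrite H0. now replace (INR d * v - INR (z O) - (INR d * w - INR (z O)))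
  with (INR d * v - INR d * w) by ring.
Qed.

End Expansions.

(** * A point of the limsup set outside a light family of cylinders *)

(** The prefix order: the cylinder of [w] lies inside that of [u]. *)
Definition ext (u w : list nat) : Prop := exists z, w = u ++ z.

Lemma ext_refl w : ext w w.
Proof. exists nil; now rewrite app_nil_r. Qed.

Lemma ext_snoc u w e : ext u w -> ext u (w ++ e :: nil).
Proof. intros [z ->]. exists (z ++ e :: nil). now rewrite app_assoc. Qed.

Lemma ext_trans u v w : ext u v -> ext v w -> ext u w.
Proof. intros [z ->] [z' ->]. exists (z ++ z'). now rewrite app_assoc. Qed.

Lemma ext_length u w : ext u w -> (length u <= length w)%nat.
Proof. intros [z ->]. rewrite length_app; lia. Qed.

Lemma ext_of_snoc u w e : ext u (w ++ e :: nil) -> u = w ++ e :: nil \/ ext u w.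
Proof.
intros [z Hz]. destruct z as [|a z] using rev_ind.
- left. rewrite app_nil_r in Hz; auto.
- right. rewrite app_assoc in Hz. apply app_inj_tail in Hz as [-> _]. now exists z.
Qed.

Lemma ext_nth u w i : ext u w -> (i < length u)%nat -> nth i w 0%nat = nth i u 0%nat.
Proof. intros [z ->] Hi. now apply app_nth1. Qed.

Lemma lsum_ge_term {A} (phi : A -> R) l a : (forall b, 0 <= phi b) -> In a l -> phi a <= lsum phi l.
Proof.
intros Hp Ha. apply Rle_trans with (lsum phi (a :: nil)); [simpl; lra|].
apply lsum_incl; auto.
- repeat constructor; auto.
- intros b [<-|[]]; auto.
Qed.

Lemma lsum_neq (l : list nat) a : NoDup l ->
  INR (length l) - 1 <= lsum (fun e => if Nat.eq_dec e a then 0 else 1) l.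
Proof.
intros Hl.
assert (H1 : lsum (fun e => if Nat.eq_dec e a then 1 else 0) l <= 1).
{ apply lsum_unique; auto; [lra| |].
  - intros e _; destruct (Nat.eq_dec e a); lra.
  - intros e e' _ _ Hne; destruct (Nat.eq_dec e a), (Nat.eq_dec e' a); subst; try lra; congruence. }
assert (H2 : lsum (fun e => (if Nat.eq_dec e a then 1 else 0) + (if Nat.eq_dec e a then 0 else 1)) l
   = INR (length l)).
{ rewrite (lsum_ext _ (fun _ => 1)); [rewrite lsum_const; lra|].
  intros e _; destruct (Nat.eq_dec e a); lra. }
rewrite lsum_plus in H2. lra.
Qed.

(** * The cost carried inside each cylinder *)

Section Load.

Variables (E : list nat) (C : nat -> list nat) (c : nat -> R) (b : R).
Hypothesis hE : NoDup E.
Hypothesis hc : forall i, 0 <= c i.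
Hypothesis hb : forall n, lsum c (seq 0 n) <= b.

Let weight (w : list nat) (i : nat) : R :=
  if excluded_middle_informative (ext w (C i)) then c i else 0.

Lemma weight_nonneg w i : 0 <= weight w i.
Proof. unfold weight; destruct excluded_middle_informative; auto; lra. Qed.

(** [load w] is the total cost of the [C i] inside the cylinder of [w], a limit of bounded growing
    sums. No [C i] lies in two children of [w], and one equal to [w] lies in none, whence the
    inequality in the second clause. *)
Lemma load_ex : exists load : list nat -> R,
  (forall w, 0 <= load w) /\
  (forall w, lsum (fun e => load (w ++ e :: nil)) E <= load w) /\
  (forall i, c i <= load (C i)) /\ load nil <= b.
Proof.
assert (Hgr : forall w, Un_growing (fun n => lsum (weight w) (seq 0 n))).
{ intros w n. rewrite lsum_seq_S. assert (H := weight_nonneg w (0 + n)). lra. }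
assert (Hub : forall w n, lsum (weight w) (seq 0 n) <= b).
{ intros w n. apply Rle_trans with (2 := hb n). apply lsum_le. intros i _.
  unfold weight; destruct excluded_middle_informative; [lra | apply hc]. }
destruct (choice (fun w l => Un_cv (fun n => lsum (weight w) (seq 0 n)) l)) as [load Hload].
{ intros w. destruct (growing_cv (fun n => lsum (weight w) (seq 0 n))) as [l Hl]; auto.
  - exists b. intros v [n ->]; auto.
  - now exists l. }
assert (Hge : forall w n, lsum (weight w) (seq 0 n) <= load w).
{ intros w n. apply (growing_ineq (fun n => lsum (weight w) (seq 0 n))); auto. }
exists load. split; [|split; [|split]].
- intros w. apply (Hge w 0%nat).
- intros w.
  apply (Un_cv_le (fun n => lsum (fun e => lsum (weight (w ++ e :: nil)) (seq 0 n)) E)).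
  + apply (Un_cv_lsum (fun n e => lsum (weight (w ++ e :: nil)) (seq 0 n)) (fun e => load (w ++ e :: nil))).
    intros e _; apply Hload.
  + intros n. apply Rle_trans with (2 := Hge w n).
    rewrite lsum_exchange. apply lsum_le. intros i _.
    apply lsum_unique; auto.
    * apply weight_nonneg.
    * intros e _. unfold weight at 1. destruct excluded_middle_informative as [H|H].
      -- unfold weight. destruct excluded_middle_informative as [H'|H']; [lra|].
         exfalso; apply H'. apply (ext_trans _ (w ++ e :: nil)); auto. now exists (e :: nil).
      -- apply weight_nonneg.
    * intros e e' _ _ Hne Hpos. unfold weight in *.
      destruct excluded_middle_informative as [[z Hz]|H]; [|lra].
      destruct excluded_middle_informative as [[z' Hz']|H']; [|lra].
      exfalso. rewrite Hz, <- !app_assoc in Hz'. apply app_inv_head in Hz'. simpl in Hz'. congruence.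
- intros i. apply Rle_trans with (2 := Hge (C i) (S i)).
  apply Rle_trans with (weight (C i) i).
  + unfold weight. destruct excluded_middle_informative as [H|H]; [lra|].
    exfalso; apply H, ext_refl.
  + apply lsum_ge_term; [apply weight_nonneg | apply in_seq; lia].
- apply (Un_cv_le _ _ b (Hload nil)); auto.
Qed.

End Load.

(** * Greedy descent in the digit tree *)

Section Core.

Variables (E : list nat) (F : nat -> R) (C : nat -> list nat) (load : list nat -> R).
Local Notation k := (INR (length E)).

Hypothesis hE : NoDup E.
Hypothesis hk : 2 <= k.
Hypothesis Fpos : forall j, 0 < F j.
Hypothesis Fdec : forall j, F (S j) <= F j.
Hypothesis Fgrow : forall j, F j <= k * F (S j).
Hypothesis Funb : forall b, exists j, b <= k ^ j * F j.
Hypothesis load_nonneg : forall w, 0 <= load w.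
Hypothesis load_split : forall w, lsum (fun e => load (w ++ e :: nil)) E <= load w.
Hypothesis load_C : forall i, F (length (C i)) <= load (C i).

(** The cylinder of [w] is not swallowed by any [C i], though smaller ones may lie inside it. In the
    applications [F j] is f(d^-j); [Fgrow] and [Funb] then say that t^-delta f(t) grows without
    bound along t = d^-j. *)
Definition alive (w : list nat) : Prop := forall i, ~ ext (C i) w.

(** If the child were some [C i], its load would be at least [F (length (C i))], and [A * load < nu]
    would contradict the bound on [nu (C i)]. *)
Lemma alive_snoc nu A w e : 0 <= A ->
  (forall i, C i = w ++ e :: nil -> nu (C i) <= A * F (length (C i))) ->
  alive w -> A * load (w ++ e :: nil) < nu (w ++ e :: nil) -> alive (w ++ e :: nil).
Proof.
intros HA Hreg Hw Hnu i Hi. apply ext_of_snoc in Hi as [Hi|Hi]; [|now apply (Hw i)].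
assert (Hr := Hreg i Hi). assert (Hc := load_C i).
apply Rmult_le_compat_l with (r := A) in Hc; auto. rewrite Hi in *. lra.
Qed.

(** Outside [T] the mass [nu] is not lost in passing to the children, while the load of the children
    does not exceed that of the parent; so some child inherits [A * load < nu]. Past length [L] this
    inequality is impossible, so the descent has to stop in [T]. *)
Lemma greedy_descent (nu : list nat -> R) (A : R) (T : list nat -> Prop) (L : nat) (u : list nat) :
  0 <= A -> (forall w, (L < length w)%nat -> nu w <= 0) ->
  (forall w, ext u w -> ~ T w -> nu w <= lsum (fun e => nu (w ++ e :: nil)) E) ->
  (forall i, ext u (C i) -> nu (C i) <= A * F (length (C i))) ->
  incl u E -> alive u -> A * load u < nu u ->
  exists v, ext u v /\ incl v E /\ T v /\ alive v /\ A * load v < nu v.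
Proof.
intros HA HL Hsub Hreg HuE Hu Hnu.
(* Here [n] is fuel, bounding the number of levels left before the length exceeds [L]. *)
assert (H : forall n w, (L < length w + n)%nat -> ext u w -> incl w E -> alive w -> A * load w < nu w ->
  exists v, ext u v /\ incl v E /\ T v /\ alive v /\ A * load v < nu v).
{ induction n as [|n IH]; intros w Hn He Hi Ha Hw.
  - exfalso. specialize (HL w). assert (0 <= A * load w) by (apply Rmult_le_pos; auto).
    assert (nu w <= 0) by (apply HL; lia). lra.
  - destruct (classic (T w)) as [HT|HT]; [now exists w|].
    assert (Hs := Hsub w He HT). assert (Hl := load_split w).
    apply Rmult_le_compat_l with (r := A) in Hl; auto. rewrite <- lsum_scal in Hl.
    destruct (lsum_lt_ex (fun e => A * load (w ++ e :: nil)) (fun e => nu (w ++ e :: nil)) E) as [e [HeE Hlt]];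
      [lra|].
    apply (IH (w ++ e :: nil)); auto.
    + rewrite length_app; simpl; lia.
    + now apply ext_snoc.
    + apply incl_app; auto. intros a [<-|[]]; auto.
    + apply (alive_snoc nu A); auto. intros i Hi'. apply Hreg. rewrite Hi'. now apply ext_snoc. }
apply (H (S L) u); auto using ext_refl. lia.
Qed.

Lemma k_pow_pos n : 0 < k ^ n.
Proof. apply pow_lt; lra. Qed.

(** [k ^ j * F j] is the discrete form of t^-delta f(t) at t = d^-j. *)
Lemma G_mono i j : (i <= j)%nat -> k ^ i * F i <= k ^ j * F j.
Proof.
induction 1 as [|j _ IH]; [lra|]. apply Rle_trans with (1 := IH). simpl.
assert (H := Fgrow j). assert (Hp := k_pow_pos j). nra.
Qed.

Lemma F_mono i j : (i <= j)%nat -> F j <= F i.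
Proof. induction 1 as [|j _ IH]; [lra|]. assert (H := Fdec j). lra. Qed.

(** The mass is spread uniformly and cut off after level [l], so the stopping word has length
    exactly [l]. *)
Lemma descend (u : list nat) (l : nat) (A : R) : 0 < A -> (length u <= l)%nat ->
  (forall i, ext u (C i) -> (length (C i) <= l)%nat -> / k ^ length (C i) <= A * F (length (C i))) ->
  incl u E -> alive u -> A * load u < / k ^ length u ->
  exists v, ext u v /\ incl v E /\ length v = l /\ alive v /\ A * load v < / k ^ l.
Proof.
intros HA Hl Hreg Hi Ha Hu.
set (nu := fun w : list nat => if le_lt_dec (length w) l then / k ^ length w else 0).
destruct (greedy_descent nu A (fun w => (l <= length w)%nat) l u) as [v [Hv1 [Hv2 [Hv3 [Hv4 Hv5]]]]]; auto.
- lra.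
- intros w Hw. unfold nu. destruct le_lt_dec; [lia | lra].
- intros w _ Hw. apply Req_le.
  rewrite (lsum_ext _ (fun _ => / k ^ S (length w))).
  + rewrite lsum_const. unfold nu. destruct le_lt_dec; [|lia]. simpl.
    assert (Hp := k_pow_pos (length w)). field; lra.
  + intros e _. unfold nu. rewrite length_app. simpl length. rewrite Nat.add_1_r.
    destruct le_lt_dec; [auto | lia].
- intros i He. unfold nu. destruct le_lt_dec; auto.
  apply Rmult_le_pos; [lra | left; apply Fpos].
- unfold nu. destruct le_lt_dec; [auto | lia].
- exists v. unfold nu in Hv5. destruct le_lt_dec as [Hle|Hlt].
  + assert (length v = l) as Hlv by lia. rewrite Hlv in Hv5. auto.
  + exfalso. assert (0 <= A * load v) by (apply Rmult_le_pos; [lra | auto]). lra.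
Qed.

Variable x : nat -> nat.
Hypothesis hx : digits E x.

Definition matches (m : nat) (w : list nat) : Prop :=
  nth m w 0%nat <> x m /\ forall j, (m < j < length w)%nat -> nth j w 0%nat = x j.

(** [m] is the last place where [w] disagrees with [x]. Hence at most one target is in progress at a
    given word. *)
Lemma matches_unique m m' w : (m < length w)%nat -> (m' < length w)%nat ->
  matches m w -> matches m' w -> m = m'.
Proof.
intros Hm Hm' [H1 H2] [H1' H2'].
destruct (lt_eq_lt_dec m m') as [[H|H]|H]; auto; exfalso.
- apply H1', H2; lia.
- apply H1, H2'; lia.
Qed.

(** [w] has passed the mismatch at [m] and has not left the block that must copy [x]. *)
Definition active (g : nat -> nat) (m : nat) (w : list nat) : Prop :=
  (m < length w <= S m + g m)%nat /\ matches m w.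

(* The number of targets of index m, that is words v of length m + 1 + g m with [matches m v],
   which extend w. *)
Definition cnt (g : nat -> nat) (m : nat) (w : list nat) : R :=
  if le_lt_dec (length w) m then (k - 1) * k ^ (m - length w)
  else if excluded_middle_informative (active g m w) then 1 else 0.

Lemma cnt_nonneg g m w : 0 <= cnt g m w.
Proof.
unfold cnt. destruct le_lt_dec.
- apply Rmult_le_pos; [lra | left; apply k_pow_pos].
- destruct excluded_middle_informative; lra.
Qed.

(** Before level [m] the count is the same for all words of a given length; at level [m] the digits
    other than [x m] survive; inside the block the one child copying [x] does. The excluded word is
    a completed target, which no child continues. *)
Lemma cnt_split g m w : ~ (length w = (S m + g m)%nat /\ matches m w) ->
  cnt g m w <= lsum (fun e => cnt g m (w ++ e :: nil)) E.
Proof.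
intros HnT. assert (Hlen : forall e, length (w ++ e :: nil) = S (length w))
  by (intros; rewrite length_app; simpl; lia).
destruct (lt_eq_lt_dec (length w) m) as [[Hl|Hl]|Hl].
- apply Req_le. rewrite (lsum_ext _ (fun _ => (k - 1) * k ^ (m - S (length w)))).
  + rewrite lsum_const. unfold cnt. destruct le_lt_dec; [|lia].
    replace (m - length w)%nat with (S (m - S (length w))) by lia. simpl; ring.
  + intros e _. unfold cnt. rewrite Hlen. destruct le_lt_dec; [auto | lia].
- apply Rle_trans with (k - 1).
  { unfold cnt. destruct le_lt_dec; [|lia]. rewrite Hl, Nat.sub_diag; simpl; lra. }
  apply Rle_trans with (1 := lsum_neq E (x m) hE). apply lsum_le. intros e _.
  destruct (Nat.eq_dec e (x m)) as [He|He]; [apply cnt_nonneg|].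
  unfold cnt. destruct le_lt_dec as [Hle|Hle]; [rewrite Hlen in Hle; lia|].
  destruct excluded_middle_informative as [H|H]; [lra|].
  exfalso; apply H. split; [rewrite Hlen; lia|]. split.
  + rewrite <- Hl, app_nth2, Nat.sub_diag by lia. simpl; congruence.
  + intros j. rewrite Hlen; lia.
- unfold cnt at 1. destruct le_lt_dec; [lia|].
  destruct excluded_middle_informative as [[[H1 H2] [H3 H4]]|H];
    [|apply lsum_nonneg; intros; apply cnt_nonneg].
  apply Rle_trans with (cnt g m (w ++ x (length w) :: nil));
    [|apply (lsum_ge_term (fun e => cnt g m (w ++ e :: nil))); auto; intros; apply cnt_nonneg].
  assert (length w <> S m + g m)%nat by (intros He; apply HnT; now repeat split).
  unfold cnt. destruct le_lt_dec as [Hle|Hle]; [rewrite Hlen in Hle; lia|].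
  destruct excluded_middle_informative as [H'|H']; [lra|].
  exfalso; apply H'. split; [rewrite Hlen; lia|]. split.
  + now rewrite app_nth1.
  + intros j. rewrite Hlen. intros Hj. destruct (Nat.eq_dec j (length w)) as [->|Hne].
    * rewrite app_nth2, Nat.sub_diag by lia. reflexivity.
    * rewrite app_nth1 by lia. apply H4; lia.
Qed.

(** Each target with index in a finite range gets the weight [F] of its length, and the resulting
    mass [nu] is normalised by [nu u = F (length u)]. It is at most twice [F (length w)] on every
    [w] at least as long as [u], so the descent runs with [A = 2]; at the target reached, the two
    factors 2 cancel. *)
Lemma jump (g : nat -> nat) (u : list nat) (s : nat) :
  (forall b, exists n, b <= lsum (fun m => k ^ m * F (S m + g m)) (seq 0 n)) ->
  incl u E -> alive u -> 2 * load u < F (length u) ->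
  exists v m, ext u v /\ incl v E /\ alive v /\ load v < F (length v) /\
    (s <= m)%nat /\ (length u <= m)%nat /\ length v = (S m + g m)%nat /\ matches m v.
Proof.
intros Hdiv Hi Ha Hu.
set (l := length u). set (m0 := Nat.max s l). set (h := fun m => k ^ m * F (S m + g m)).
assert (Hh : forall m, 0 <= h m).
{ intros m. apply Rmult_le_pos; left; [apply k_pow_pos | apply Fpos]. }
(* The indices below [m0] are discarded, so their sum is added to what is asked of the divergent
   series. The rest still gives [T >= F l], which makes the normalising factor [c] at most 1. *)
destruct (Hdiv (lsum h (seq 0 m0) + k ^ l * F l)) as [n Hn]. fold h in Hn.
set (ms := seq m0 n).
assert (Hms : forall m, In m ms -> (s <= m)%nat /\ (l <= m)%nat)
  by (intros m Hm; apply in_seq in Hm; lia).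
set (T := lsum (fun m => F (S m + g m)%nat * cnt g m u) ms).
assert (HT : F l <= T).
{ assert (H1 : k ^ l * F l <= lsum h ms).
  { assert (H := lsum_seq_mono h 0 n (m0 + n) Hh). rewrite seq_app, lsum_app in H.
    simpl in H. unfold ms. specialize (H ltac:(lia)). lra. }
  apply Rmult_le_reg_l with (k ^ l); [apply k_pow_pos|]. apply Rle_trans with (1 := H1).
  unfold T. rewrite <- lsum_scal. apply lsum_le. intros m Hm. apply Hms in Hm as [_ Hm].
  unfold h, cnt. destruct le_lt_dec; [|unfold l in *; lia]. fold l.
  replace m with (l + (m - l))%nat at 1 by lia. rewrite pow_add.
  assert (Hp := Fpos (S m + g m)). assert (Hp1 := k_pow_pos l). assert (Hp2 := k_pow_pos (m - l)).
  assert (Hp3 : 0 < k ^ l * k ^ (m - l) * F (S m + g m)%nat) by (repeat apply Rmult_lt_0_compat; auto).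
  replace (k ^ l * (F (S m + g m)%nat * ((k - 1) * k ^ (m - l)))) with
    ((k - 1) * (k ^ l * k ^ (m - l) * F (S m + g m)%nat)) by ring.
  nra. }
assert (HFl := Fpos l).
set (c := F l / T).
assert (HcT : c * T = F l) by (unfold c; field; lra).
assert (Hc0 : 0 < c) by (unfold c; apply Rdiv_lt_0_compat; lra).
assert (Hc1 : c <= 1) by (apply Rmult_le_reg_r with T; lra).
set (nu := fun w => c * lsum (fun m => F (S m + g m)%nat * cnt g m w) ms).
assert (Hreg : forall w, (l <= length w)%nat -> nu w <= 2 * F (length w)).
{ intros w Hw. set (j := length w).
  set (act := fun m => if excluded_middle_informative (active g m w) then F j else 0).
  assert (Hact : lsum act ms <= F j).
  { apply lsum_unique.
    - left; apply Fpos.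
    - apply seq_NoDup.
    - intros m _. unfold act. destruct excluded_middle_informative; [lra | left; apply Fpos].
    - intros m m' _ _ Hne. unfold act.
      destruct excluded_middle_informative as [[H1 H2]|H]; [|lra].
      destruct excluded_middle_informative as [[H1' H2']|H']; [|lra].
      exfalso. apply Hne, (matches_unique m m' w); auto; lia. }
  (* Targets starting at or after the end of [w] are shared equally among the words of that length,
     whence [k ^ l / k ^ j]. The one active target counts once, with weight at most [F j]. *)
  assert (HS : lsum (fun m => F (S m + g m)%nat * cnt g m w) ms <= k ^ l / k ^ j * T + F j).
  { apply Rle_trans with (k ^ l / k ^ j * T + lsum act ms); [|lra].
    unfold T. rewrite <- lsum_scal, <- lsum_plus. apply lsum_le. intros m Hm.
    apply Hms in Hm as [_ Hm]. assert (Hp := Fpos (S m + g m)).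
    assert (Hpl := k_pow_pos l). assert (Hpj := k_pow_pos j).
    assert (Hr : 0 < k ^ l / k ^ j) by now apply Rdiv_lt_0_compat.
    assert (Hcu : 0 <= k ^ l / k ^ j * (F (S m + g m)%nat * cnt g m u)).
    { apply Rmult_le_pos; [lra|]. apply Rmult_le_pos; [lra | apply cnt_nonneg]. }
    unfold cnt at 1. destruct le_lt_dec as [Hle|Hlt].
    - assert (0 <= act m).
      { unfold act. destruct excluded_middle_informative; [left; apply Fpos | lra]. }
      enough (F (S m + g m)%nat * ((k - 1) * k ^ (m - length w)) =
        k ^ l / k ^ j * (F (S m + g m)%nat * cnt g m u)) by lra.
      unfold cnt. destruct le_lt_dec; [|unfold l in *; lia]. fold l j.
      replace (m - l)%nat with ((j - l) + (m - j))%nat by (unfold j; unfold j in *; lia).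
      rewrite pow_add.
      assert (Hj : k ^ j = k ^ l * k ^ (j - l)) by (rewrite <- pow_add; f_equal; unfold j; lia).
      rewrite Hj. assert (Hpjl := k_pow_pos (j - l)). field; lra.
    - unfold act. destruct excluded_middle_informative as [[Hact1 Hact2]|H]; [|lra].
      assert (F (S m + g m)%nat <= F j) by (apply F_mono; unfold j; lia). lra. }
  unfold nu. apply Rmult_le_compat_l with (r := c) in HS; [|lra].
  apply Rle_trans with (1 := HS).
  (* Monotonicity of [k ^ j * F j] bounds the uniform share of [F l] by [F j]. *)
  assert (HG := G_mono l j Hw). assert (Hpj := k_pow_pos j).
  assert (c * (k ^ l / k ^ j * T) <= F j).
  { replace (c * (k ^ l / k ^ j * T)) with (k ^ l / k ^ j * (c * T)) by ring. rewrite HcT.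
    apply Rmult_le_reg_l with (k ^ j); auto.
    replace (k ^ j * (k ^ l / k ^ j * F l)) with (k ^ l * F l) by (field; lra). auto. }
  assert (HFj := Fpos j). nra. }
assert (HL : exists L, forall m, In m ms -> (S m + g m <= L)%nat).
{ clear. induction ms as [|a ms [L IH]].
  - exists O; intros m [].
  - exists (Nat.max L (S a + g a)). intros m [<-|Hm]; [lia|]. specialize (IH m Hm); lia. }
destruct HL as [L HL].
destruct (greedy_descent nu 2 (fun w => exists m, In m ms /\ length w = (S m + g m)%nat /\ matches m w) L u)
  as [v [Hv1 [Hv2 [[m [Hm1 [Hm2 Hm3]]] [Hv4 Hv5]]]]]; auto.
- lra.
- intros w Hw. unfold nu. rewrite (lsum_ext _ (fun _ => 0)); [rewrite lsum_const; lra|].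
  intros m Hm. specialize (HL m Hm). unfold cnt. destruct le_lt_dec; [lia|].
  destruct excluded_middle_informative as [[H1 _]|H]; [lia | ring].
- intros w _ HnT. unfold nu. rewrite lsum_scal. apply Rmult_le_compat_l; [lra|].
  rewrite lsum_exchange. apply lsum_le. intros m Hm. rewrite lsum_scal.
  apply Rmult_le_compat_l; [left; apply Fpos|]. apply cnt_split.
  intros HT'. apply HnT. now exists m.
- intros i Hi'. apply Hreg. now apply ext_length.
- unfold nu. fold T. rewrite HcT. exact Hu.
- exists v, m. destruct (Hms m Hm1). repeat split; auto; try apply Hm3.
  assert (Hr := Hreg v (ext_length _ _ Hv1)). lra.
Qed.

Definition light (u : list nat) : Prop := incl u E /\ alive u /\ load u < F (length u).

Lemma next_target (g : nat -> nat) (u : list nat) (s : nat) :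
  (forall b, exists n, b <= lsum (fun m => k ^ m * F (S m + g m)) (seq 0 n)) ->
  light u -> exists v, ext u v /\ light v /\ (length u < length v)%nat /\
    exists m, (s <= m)%nat /\ length v = (S m + g m)%nat /\ matches m v.
Proof.
intros Hdiv [Hi [Ha Hu]].
set (G := fun j => k ^ j * F j).
assert (HG : forall j, 0 < G j) by (intros; apply Rmult_lt_0_compat; [apply k_pow_pos | apply Fpos]).
destruct (Funb (2 * G (length u))) as [l0 Hl0]. set (l := Nat.max l0 (length u)).
assert (Hl : 2 * G (length u) <= G l)
  by (apply Rle_trans with (1 := Hl0), G_mono; unfold l; lia).
assert (HGu := HG (length u)).
destruct (descend u l (/ G (length u))) as [v [Hv1 [Hv2 [Hv3 [Hv4 Hv5]]]]]; auto.
- now apply Rinv_0_lt_compat.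
- unfold l; lia.
- intros i He _. assert (Hm := G_mono _ _ (ext_length _ _ He)). fold (G (length u)) in Hm.
  assert (Hp := k_pow_pos (length (C i))).
  apply Rmult_le_reg_l with (k ^ length (C i) * G (length u)); [now apply Rmult_lt_0_compat|].
  replace (k ^ length (C i) * G (length u) * / k ^ length (C i)) with (G (length u)) by (field; lra).
  replace (k ^ length (C i) * G (length u) * (/ G (length u) * F (length (C i))))
    with (k ^ length (C i) * F (length (C i))) by (field; lra).
  exact Hm.
- assert (Hp := k_pow_pos (length u)).
  apply Rmult_lt_reg_l with (G (length u)); auto.
  rewrite <- Rmult_assoc, Rinv_r, Rmult_1_l by lra. apply Rlt_le_trans with (1 := Hu).
  apply Req_le. unfold G. field; lra.
- destruct (jump g v s Hdiv) as [w [m [Hw1 [Hw2 [Hw3 [Hw4 [Hw5 [Hw6 [Hw7 Hw8]]]]]]]]]; auto.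
  + rewrite Hv3. assert (Hp := k_pow_pos l).
    apply Rmult_lt_compat_l with (r := G (length u)) in Hv5; auto.
    rewrite <- Rmult_assoc, Rinv_r, Rmult_1_l in Hv5 by lra.
    assert (G (length u) * / k ^ l * 2 <= F l); [|lra].
    apply Rmult_le_reg_l with (k ^ l); auto.
    replace (k ^ l * (G (length u) * / k ^ l * 2)) with (2 * G (length u)) by (field; lra). exact Hl.
  + exists w. split; [now apply (ext_trans u v)|]. split; [now split|]. split.
    * assert (H := ext_length _ _ Hv1). lia.
    * exists m. repeat split; auto; apply Hw8.
Qed.

Variable g : nat -> nat -> nat.
Hypothesis Hdiv : forall s b, exists n, b <= lsum (fun m => k ^ m * F (S m + g s m)) (seq 0 n).

(** Stage [s] uses the block lengths [g s] and an index at least [s], so a single point serves all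
    accuracies. *)
Lemma limit_point (u : list nat) : light u ->
  exists y, digits E y /\ (forall i, exists j, (j < length (C i))%nat /\ nth j (C i) 0%nat <> y j) /\
    forall s, exists m, (s <= m)%nat /\ y m <> x m /\
      forall j, (m < j < S m + g s m)%nat -> y j = x j.
Proof.
intros Hu.
set (P := fun s (u v : list nat) => ext u v /\ light v /\ (length u < length v)%nat /\
    exists m, (s <= m)%nat /\ length v = (S m + g s m)%nat /\ matches m v).
destruct (choice (fun (p : nat * list nat) v => light (snd p) -> P (fst p) (snd p) v)) as [next Hnext].
{ intros [s w]. destruct (classic (light w)) as [Hw|Hw].
  - destruct (next_target (g s) w s (Hdiv s) Hw) as [v Hv]. now exists v.
  - exists nil. intros Hw'; contradiction. }
set (us := fix us n := match n with O => u | S n => next (n, us n) end).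
assert (Hgood : forall n, light (us n)).
{ induction n as [|n IH]; auto. now apply (Hnext (n, us n)). }
assert (HP : forall n, P n (us n) (us (S n))) by (intros n; apply (Hnext (n, us n)), Hgood).
assert (Hlen : forall n, (n <= length (us n))%nat).
{ induction n as [|n IH]; [lia|]. destruct (HP n) as [_ [_ [H _]]]. lia. }
assert (Hext : forall n m, (n <= m)%nat -> ext (us n) (us m)).
{ induction 1 as [|m _ IH]; [apply ext_refl|]. apply (ext_trans _ (us m)); auto. apply HP. }
(* The lengths strictly increase, so [us (S i)] has more than [i] letters and the default 0 is never
   read. *)
set (y := fun i => nth i (us (S i)) 0%nat).
assert (Hy : forall n i, (i < length (us n))%nat -> nth i (us n) 0%nat = y i).
{ intros n i Hi. unfold y. destruct (le_lt_dec n (S i)) as [H|H].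
  - symmetry. apply ext_nth; auto.
  - apply ext_nth; [apply Hext; lia | apply Hlen]. }
exists y. split; [|split].
- intros i. unfold y. destruct (Hgood (S i)) as [H _]. apply H, nth_In, Hlen.
- intros i. apply NNPP; intros Hn.
  destruct (Hgood (length (C i))) as [_ [Ha _]]. apply (Ha i).
  exists (skipn (length (C i)) (us (length (C i)))).
  rewrite <- (firstn_skipn (length (C i)) (us (length (C i)))) at 1. f_equal.
  assert (HL := Hlen (length (C i))).
  apply (nth_ext _ _ 0%nat 0%nat).
  + rewrite length_firstn; lia.
  + rewrite length_firstn. intros j Hj. rewrite nth_firstn, (proj2 (Nat.ltb_lt _ _)) by lia.
    rewrite Hy by lia. apply NNPP; intros Hne. apply Hn. exists j. split; [lia | congruence].
- intros s. destruct (HP s) as [_ [_ [_ [m [Hm1 [Hm2 [Hm3 Hm4]]]]]]].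
  exists m. split; auto. split.
  + rewrite <- (Hy (S s)); auto; lia.
  + intros j Hj. rewrite <- (Hy (S s)) by lia. apply Hm4; lia.
Qed.

(** A light word to start from is found at level [J0]: down to there the load can be compared with
    the uniform mass, as no [C i] is shorter. *)
Lemma limsup_avoids (J0 : nat) : (forall i, (J0 <= length (C i))%nat) ->
  load nil < k ^ J0 * F J0 ->
  exists y, digits E y /\ (forall i, exists j, (j < length (C i))%nat /\ nth j (C i) 0%nat <> y j) /\
    forall s, exists m, (s <= m)%nat /\ y m <> x m /\
      forall j, (m < j < S m + g s m)%nat -> y j = x j.
Proof.
intros HJ Hload. set (G0 := k ^ J0 * F J0) in *. assert (Hp := k_pow_pos J0). assert (HF := Fpos J0).
assert (HG0 : 0 < G0) by now apply Rmult_lt_0_compat.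
(* An empty [C i] forces [J0 = 0], and then [F 0 <= load nil < F 0]. *)
assert (Hnil : alive nil).
{ intros i [z Hz]. symmetry in Hz. apply app_eq_nil in Hz as [Hz _].
  assert (HC := load_C i). rewrite Hz in HC. specialize (HJ i). rewrite Hz in HJ. simpl in HJ.
  assert (H0 : J0 = O) by lia. subst J0. unfold G0 in Hload. simpl in *. lra. }
destruct (descend nil J0 (/ G0)) as [u [_ [Hu2 [Hu3 [Hu4 Hu5]]]]]; auto.
- now apply Rinv_0_lt_compat.
- simpl; lia.
- intros i _ Hl. replace (length (C i)) with J0 by (specialize (HJ i); lia).
  apply Req_le. unfold G0. field; lra.
- intros a [].
- simpl. rewrite Rinv_1. apply Rmult_lt_reg_l with G0; auto.
  rewrite <- Rmult_assoc, Rinv_r by lra. lra.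
- apply (limit_point u). split; [|split]; auto. rewrite Hu3.
  apply Rmult_lt_compat_l with (r := G0) in Hu5; auto.
  rewrite <- Rmult_assoc, Rinv_r, Rmult_1_l in Hu5 by lra.
  replace (G0 * / k ^ J0) with (F J0) in Hu5 by (unfold G0; field; lra). exact Hu5.
Qed.

End Core.

(** * Covers by cylinders *)

Definition prefix (y : nat -> nat) (n : nat) : list nat := map y (seq 0 n).

Lemma length_prefix y n : length (prefix y n) = n.
Proof. unfold prefix; now rewrite length_map, length_seq. Qed.

Lemma nth_prefix y n i : (i < n)%nat -> nth i (prefix y n) 0%nat = y i.
Proof.
intros Hi. unfold prefix. rewrite (nth_indep _ _ (y 0%nat)) by (rewrite length_map, length_seq; lia).
rewrite map_nth, seq_nth; auto.
Qed.

Lemma prefix_S y n : prefix y (S n) = y O :: prefix (shift 1 y) n.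
Proof. unfold prefix; simpl. f_equal. now rewrite <- seq_shift, map_map. Qed.

Lemma prefix_app y n m : prefix y (n + m) = prefix y n ++ prefix (shift n y) m.
Proof.
revert y; induction n as [|n IH]; intros y; [reflexivity|].
rewrite Nat.add_succ_l, !prefix_S, IH. reflexivity.
Qed.

Fixpoint words (E : list nat) (l : nat) : list (list nat) :=
  match l with
  | O => nil :: nil
  | S l => flat_map (fun e => map (cons e) (words E l)) E
  end.

Lemma prefix_words E y l : digits E y -> In (prefix y l) (words E l).
Proof.
revert y; induction l as [|l IH]; intros y Hy; [now left|].
rewrite prefix_S; simpl. apply in_flat_map. exists (y O). split; [apply Hy|].
apply in_map, IH. now apply digits_shift.
Qed.

Lemma lsum_words_S E l phi :
  lsum phi (words E (S l)) = lsum (fun e => lsum (fun w => phi (e :: w)) (words E l)) E.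
Proof. simpl. rewrite lsum_flat_map. apply lsum_ext. intros; apply lsum_map. Qed.

Lemma lsum_words_1 E l : lsum (fun _ => 1) (words E l) = INR (length E) ^ l.
Proof.
induction l as [|l IH]; [simpl; lra|].
rewrite lsum_words_S, (lsum_ext _ (fun _ => INR (length E) ^ l)) by auto.
rewrite lsum_const; simpl; ring.
Qed.

Lemma INR_length_words E l : INR (length (words E l)) = INR (length E) ^ l.
Proof. rewrite <- lsum_words_1, lsum_const; ring. Qed.

Lemma length_words E l : length (words E l) = (length E ^ l)%nat.
Proof. apply INR_eq. now rewrite INR_length_words, pow_INR. Qed.

Lemma length_flat_map_const {A B} (h : A -> list B) l c :
  (forall a, In a l -> length (h a) = c) -> length (flat_map h l) = (length l * c)%nat.
Proof.
induction l as [|a l IH]; simpl; intros H; auto.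
rewrite length_app, IH, H; auto.
Qed.

Lemma length_filter_lsum {A} (p : A -> bool) l :
  INR (length (filter p l)) = lsum (fun a => if p a then 1 else 0) l.
Proof.
induction l as [|a l IH]; simpl; auto. destruct (p a); rewrite <- IH; [|lra].
change (length (a :: filter p l)) with (S (length (filter p l))). rewrite S_INR; lra.
Qed.

Lemma cylinder_cover (d : nat) (E : list nat) f eta Q b n (W : list (list nat)) :
  (2 <= d)%nat -> (forall e, In e E -> (e < d)%nat) -> nonneg_gauge f -> 0 < eta ->
  (forall v, Q v -> exists y, digits E y /\ isval d y v /\ In (prefix y n) W) ->
  / INR d ^ n <= eta -> INR (length W) * f (/ INR d ^ n) <= b ->
  interval_cover f eta Q b.
Proof.
intros Hd HE Hf He HS Hn Hb.
assert (Hp : 0 < / INR d ^ n) by now apply Rinv_0_lt_compat, pow_lt_dim.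
apply (interval_cover_lists f eta Q b (fun j => match j with
  | O => map (fun w => (trunc d (fun i => nth i w 0%nat) n, / INR d ^ n)) W
  | _ => nil end)); auto.
- intros [|j] p Hi; [|destruct Hi]. apply in_map_iff in Hi as [w [<- _]]; simpl; lra.
- intros v Hv. destruct (HS v Hv) as [y [Hy1 [Hy2 Hy3]]].
  exists O, (trunc d y n, / INR d ^ n). split.
  + apply in_map_iff. exists (prefix y n). split; auto. f_equal.
    apply trunc_ext. intros; now apply nth_prefix.
  + simpl. now apply (trunc_approx d E).
- assert (H0 : lsum (fun p => fcost f (snd p))
      (map (fun w => (trunc d (fun i => nth i w 0%nat) n, / INR d ^ n)) W) <= b).
  { rewrite lsum_map; simpl. rewrite lsum_const, fcost_pos by auto. lra. }
  assert (Hb0 : 0 <= b).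
  { apply Rle_trans with (2 := Hb). apply Rmult_le_pos; [apply pos_INR | now apply Hf]. }
  intros [|m]; [simpl; auto|].
  rewrite <- cons_seq, <- seq_shift.
  match goal with |- lsum ?phi (0%nat :: ?l) <= _ => change (phi 0%nat + lsum phi l <= b) end.
  rewrite lsum_map. simpl (lsum _ nil). rewrite lsum_const. lra.
Qed.

(** * Almost every point lies in the limsup set *)

Lemma lsum_seq_unbounded_tail (h : nat -> R) (m0 : nat) : (forall m, 0 <= h m) ->
  (forall b, exists n, b <= lsum h (seq 0 n)) -> forall b, exists n, b <= lsum h (seq m0 n).
Proof.
intros Hh Hdiv b. destruct (Hdiv (lsum h (seq 0 m0) + b)) as [n Hn]. exists n.
assert (H := lsum_seq_mono h 0 n (m0 + n) Hh). rewrite seq_app, lsum_app in H.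
specialize (H ltac:(lia)). simpl in H. lra.
Qed.

Lemma inv_pow_small (r : R) eta : 1 < r -> 0 < eta -> exists n0, forall n, (n0 <= n)%nat -> / r ^ n <= eta.
Proof.
intros Hr He. destruct (pow_lt_1_zero (/ r)) with (y := eta) as [N HN]; auto.
- rewrite Rabs_right; [|left; apply Rinv_0_lt_compat; lra].
  rewrite <- Rinv_1. apply Rinv_lt_contravar; lra.
- exists N. intros n Hn. specialize (HN n Hn). rewrite pow_inv in HN.
  apply Rabs_def2 in HN. lra.
Qed.

Section Avoid.

Variables (d : nat) (E : list nat) (x : nat -> nat) (g : nat -> nat).
Local Notation k := (INR (length E)).

Hypothesis hd : (2 <= d)%nat.
Hypothesis hEsub : forall e, In e E -> (e < d)%nat.
Hypothesis hE : NoDup E.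
Hypothesis hk : 2 <= k.
Hypothesis hx : digits E x.

(** A word too short for the block counts as not following, so a target whose block runs past the
    end of the word is not counted as hit. *)
Fixpoint follows (m j : nat) (w : list nat) : bool :=
  match j, w with
  | O, _ => true
  | S _, nil => false
  | S j, e :: w => andb (Nat.eqb e (x m)) (follows (S m) j w)
  end.

(* The word w, read at the positions n, n+1, ..., hits no target inside its range. *)
Fixpoint avoids (n : nat) (w : list nat) : bool :=
  match w with
  | nil => true
  | e :: w => andb (orb (Nat.eqb e (x n)) (negb (follows (S n) (g n) w))) (avoids (S n) w)
  end.

Definition navoid (n l : nat) : R := lsum (fun w => if avoids n w then 1 else 0) (words E l).

Lemma navoid_nonneg n l : 0 <= navoid n l.
Proof. apply lsum_nonneg. intros w _; destruct (avoids n w); lra. Qed.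

Lemma lsum_at (l : list nat) a c : NoDup l -> In a l ->
  lsum (fun e => if Nat.eqb e a then c else 0) l = c.
Proof.
intros Hl Ha. induction Hl as [|b l Hb Hl IH]; [destruct Ha|]. simpl.
destruct (Nat.eqb_spec b a) as [->|Hne].
- rewrite (lsum_ext _ (fun _ => 0)); [rewrite lsum_const; lra|].
  intros e He. destruct (Nat.eqb_spec e a); auto. subst; contradiction.
- destruct Ha as [|Ha]; [contradiction|]. rewrite IH; auto; lra.
Qed.

(** While a word copies [x] it has no mismatch, hence no target; only the places from [n + j] on
    constrain it. *)
Lemma navoid_follows j n l :
  lsum (fun w => if andb (follows n j w) (avoids n w) then 1 else 0) (words E (j + l)) = navoid (n + j) l.
Proof.
revert n; induction j as [|j IH]; intros n.
- simpl. rewrite Nat.add_0_r. reflexivity.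
- rewrite Nat.add_succ_l, lsum_words_S.
  rewrite (lsum_ext _ (fun e => if Nat.eqb e (x n) then navoid (n + S j) l else 0)).
  + now apply lsum_at.
  + intros e _. destruct (Nat.eqb_spec e (x n)) as [->|Hne].
    * rewrite <- Nat.add_succ_comm, <- IH. apply lsum_ext. intros w _. simpl.
      now rewrite Nat.eqb_refl.
    * rewrite (lsum_ext _ (fun _ => 0)); [rewrite lsum_const; ring|].
      intros w _. simpl. now rewrite (proj2 (Nat.eqb_neq _ _) Hne).
Qed.

Lemma navoid_S n l : navoid n (S l) <= k * navoid (S n) l.
Proof.
unfold navoid at 1. rewrite lsum_words_S.
apply Rle_trans with (lsum (fun _ => navoid (S n) l) E); [|rewrite lsum_const; lra].
apply lsum_le. intros e _. apply lsum_le. intros w _. simpl.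
destruct (avoids (S n) w); [|rewrite Bool.andb_false_r; lra].
destruct (_ && true)%bool; lra.
Qed.

Lemma navoid_add j n l : navoid n (j + l) <= k ^ j * navoid (n + j) l.
Proof.
revert n; induction j as [|j IH]; intros n.
- simpl. rewrite Nat.add_0_r. lra.
- rewrite Nat.add_succ_l. apply Rle_trans with (1 := navoid_S n (j + l)). simpl.
  rewrite Rmult_assoc, <- Nat.add_succ_comm. apply Rmult_le_compat_l; [lra | apply IH].
Qed.

(* The event "n is a target" is independent of "no target at or after n + 1 + g n" and excludes
   all targets in between, which gives a product bound instead of a second moment argument. *)
Lemma navoid_step n l : (g n <= l)%nat ->
  navoid n (S l) <= k * navoid (S n) l * (1 - (k - 1) / (k * k ^ g n)).
Proof.
intros Hg. set (A := navoid (S n) l). set (B := navoid (S n + g n) (l - g n)).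
assert (Hkg : 0 < k ^ g n) by (apply pow_lt; lra).
assert (HA : A <= k ^ g n * B).
{ unfold A, B. replace l with (g n + (l - g n))%nat at 1 by lia. apply navoid_add. }
assert (HB : 0 <= B) by apply navoid_nonneg.
assert (HS : navoid n (S l) <= k * A - (k - 1) * B).
{ unfold navoid at 1. rewrite lsum_words_S.
  rewrite (lsum_ext _ (fun e => A + (- B) * (if Nat.eq_dec e (x n) then 0 else 1))).
  - rewrite lsum_plus, lsum_scal, lsum_const. assert (H := lsum_neq E (x n) hE). nra.
  - intros e _. destruct (Nat.eq_dec e (x n)) as [->|Hne].
    + rewrite Rmult_0_r, Rplus_0_r. apply lsum_ext. intros w _. simpl.
      now rewrite Nat.eqb_refl.
    + unfold A, B. rewrite <- (navoid_follows (g n) (S n) (l - g n)).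
      replace (g n + (l - g n))%nat with l by lia. unfold navoid.
      rewrite Rmult_1_r. apply Rplus_eq_reg_r with
        (lsum (fun w => if (follows (S n) (g n) w && avoids (S n) w)%bool then 1 else 0) (words E l)).
      rewrite Rplus_assoc, Rplus_opp_l, Rplus_0_r, <- lsum_plus. apply lsum_ext. intros w _. simpl.
      rewrite (proj2 (Nat.eqb_neq _ _) Hne).
      destruct (follows (S n) (g n) w), (avoids (S n) w); simpl; lra. }
apply Rle_trans with (1 := HS).
replace (k * A * (1 - (k - 1) / (k * k ^ g n))) with (k * A - (k - 1) * (A / k ^ g n)) by (field; lra).
assert (A / k ^ g n <= B).
{ apply Rmult_le_reg_l with (k ^ g n); auto.
  replace (k ^ g n * (A / k ^ g n)) with A by (field; lra). auto. }
nra.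
Qed.

Lemma navoid_le_pow n l : navoid n l <= k ^ l.
Proof.
rewrite <- lsum_words_1. apply lsum_le. intros w _; destruct (avoids n w); lra.
Qed.

(** The product of the factors 1 - a is bounded by the inverse of 1 plus the sum of the a, through
    (1 - a)(1 + a + s) <= 1 + s. The extra [l] letters make room for the blocks of all [p]
    places. *)
Lemma navoid_decay p n l : (forall m, (n <= m < n + p)%nat -> (g m <= l)%nat) ->
  navoid n (p + l) * (1 + lsum (fun m => (k - 1) / (k * k ^ g m)) (seq n p)) <= k ^ (p + l).
Proof.
revert n; induction p as [|p IH]; intros n Hg.
- simpl. rewrite Rplus_0_r, Rmult_1_r. apply navoid_le_pow.
- set (a := fun m => (k - 1) / (k * k ^ g m)).
  assert (Ha : forall m, 0 <= a m <= 1).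
  { intros m. assert (Hp : 1 <= k ^ g m) by (apply pow_R1_Rle; lra). unfold a.
    assert (0 < k * k ^ g m) by nra. split.
    - apply Rmult_le_pos; [lra | left; now apply Rinv_0_lt_compat].
    - apply Rmult_le_reg_r with (k * k ^ g m); auto.
      unfold Rdiv. rewrite Rmult_assoc, Rinv_l by lra. nra. }
  specialize (IH (S n)).
  assert (IH' := IH ltac:(intros m Hm; apply Hg; lia)). clear IH. fold a in IH'.
  assert (Hs := navoid_step n (p + l)).
  specialize (Hs ltac:(specialize (Hg n); lia)). fold (a n) in Hs.
  rewrite Nat.add_succ_l, <- cons_seq. fold a.
  change (lsum a (n :: seq (S n) p)) with (a n + lsum a (seq (S n) p)).
  set (s := lsum a (seq (S n) p)) in *.
  assert (Hs0 : 0 <= s) by (apply lsum_nonneg; intros; apply Ha).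
  assert (HN := navoid_nonneg (S n) (p + l)). specialize (Ha n).
  apply Rle_trans with (k * navoid (S n) (p + l) * ((1 - a n) * (1 + (a n + s)))).
  + rewrite <- Rmult_assoc. apply Rmult_le_compat_r; [lra | exact Hs].
  + apply Rle_trans with (k * navoid (S n) (p + l) * (1 + s)).
    * apply Rmult_le_compat_l; [nra|]. nra.
    * simpl. rewrite Rmult_assoc. apply Rmult_le_compat_l; [lra | exact IH'].
Qed.

Lemma follows_prefix y m j l : follows m j (prefix (shift m y) l) = true ->
  forall i, (m <= i < m + j)%nat -> y i = x i.
Proof.
revert m l; induction j as [|j IH]; intros m l H i Hi; [lia|].
destruct l as [|l]; [discriminate|]. rewrite prefix_S in H. simpl in H.
apply Bool.andb_true_iff in H as [H1 H2]. apply Nat.eqb_eq in H1.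
unfold shift in H1 at 1. rewrite Nat.add_0_r in H1.
destruct (Nat.eq_dec i m) as [->|Hne]; auto.
apply (IH (S m) l); [|lia].
rewrite <- H2. f_equal. apply map_ext. intros a. unfold shift. f_equal. lia.
Qed.

Definition hits (y : nat -> nat) (m : nat) : Prop :=
  y m <> x m /\ forall j, (m < j < S m + g m)%nat -> y j = x j.

Lemma avoids_prefix y n l : (forall m, (n <= m)%nat -> ~ hits y m) ->
  avoids n (prefix (shift n y) l) = true.
Proof.
revert n; induction l as [|l IH]; intros n Hn; [reflexivity|].
assert (Hsh : prefix (shift 1 (shift n y)) l = prefix (shift (S n) y) l).
{ apply map_ext. intros a. unfold shift. f_equal. lia. }
rewrite prefix_S, Hsh. simpl. rewrite IH by (intros m Hm; apply Hn; lia).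
rewrite Bool.andb_true_r. unfold shift at 1. rewrite Nat.add_0_r.
destruct (Nat.eqb_spec (y n) (x n)) as [He|He]; [reflexivity|]. simpl.
destruct (follows (S n) (g n) (prefix (shift (S n) y) l)) eqn:Hf; [|reflexivity].
exfalso. apply (Hn n); auto. split; auto. intros j Hj.
apply (follows_prefix y (S n) (g n) l Hf). lia.
Qed.

(** The first [N] digits are free and the next [p + l] form an avoiding word. The proportion of such
    words is at most [eps / c] once [p] is large. *)
Lemma eventually_no_hit_null (f : R -> R) (c : R) (n0 N : nat) : nonneg_gauge f -> 0 < c ->
  (forall n, (n0 <= n)%nat -> f (/ INR d ^ n) <= c / k ^ n) ->
  (forall b, exists n, b <= lsum (fun m => / k ^ g m) (seq 0 n)) ->
  Hbound f (fun v => exists y, digits E y /\ isval d y v /\ forall m, (N <= m)%nat -> ~ hits y m) 0.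
Proof.
intros Hf Hc Hfc Hdiv eps eta He Heta.
set (a := fun m => (k - 1) / (k * k ^ g m)).
assert (Hkp : forall n, 0 < k ^ n) by (intros; apply pow_lt; lra).
(* The factor 2 makes up for (k - 1)/k >= 1/2. *)
destruct (lsum_seq_unbounded_tail (fun m => / k ^ g m) N) with (b := 2 * (c / eps)) as [p Hp]; auto.
{ intros m; left; now apply Rinv_0_lt_compat. }
assert (Ha : c / eps <= lsum a (seq N p)).
{ apply Rmult_le_reg_l with 2; [lra|]. apply Rle_trans with (1 := Hp).
  rewrite <- lsum_scal. apply lsum_le. intros m _. unfold a.
  assert (Hi : 0 < / k ^ g m) by now apply Rinv_0_lt_compat.
  replace (2 * ((k - 1) / (k * k ^ g m))) with ((2 * (k - 1) / k) * / k ^ g m)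
    by (field; specialize (Hkp (g m)); lra).
  enough (1 <= 2 * (k - 1) / k) by nra.
  apply Rmult_le_reg_r with k; [lra|]. unfold Rdiv. rewrite Rmult_assoc, Rinv_l by lra. lra. }
assert (HD : 1 < INR d) by (apply (lt_INR 1); lia).
destruct (inv_pow_small (INR d) eta HD Heta) as [n1 Hn1].
assert (HL : exists L, forall m, In m (seq N p) -> (g m <= L)%nat).
{ generalize (seq N p) as ms. induction ms as [|b ms [L IH]].
  - exists O; intros m [].
  - exists (Nat.max L (g b)). intros m [<-|Hm]; [lia|]. specialize (IH m Hm); lia. }
(* [l] exceeds all the block lengths involved, and it makes the cylinders finer than [eta] and deep
   enough for the bound on [f]. *)
destruct HL as [L HL]. set (l := Nat.max L (Nat.max n0 n1)).
assert (Hdec : navoid N (p + l) * (1 + lsum a (seq N p)) <= k ^ (p + l)).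
{ apply navoid_decay. intros m Hm. apply Nat.le_trans with L; [apply HL, in_seq; lia | unfold l; lia]. }
set (n := (N + (p + l))%nat).
set (W := flat_map (fun w => map (app w) (filter (avoids N) (words E (p + l)))) (words E N)).
apply (cylinder_cover d E f eta _ _ n W); auto.
- intros v [y [Hy1 [Hy2 Hy3]]]. exists y. split; auto. split; auto.
  unfold n. rewrite prefix_app. apply in_flat_map. exists (prefix y N). split; [now apply prefix_words|].
  apply in_map, filter_In. split; [apply prefix_words; now apply digits_shift | now apply avoids_prefix].
- apply Hn1. unfold n, l; lia.
- unfold W. rewrite (length_flat_map_const _ _ (length (filter (avoids N) (words E (p + l)))))
    by (intros; apply length_map).
  rewrite mult_INR, INR_length_words, length_filter_lsum. fold (navoid N (p + l)).
  assert (HN := navoid_nonneg N (p + l)).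
  apply Rle_trans with (k ^ N * navoid N (p + l) * (c / k ^ n)).
  + apply Rmult_le_compat_l; [apply Rmult_le_pos; auto; left; auto|].
    apply Hfc. unfold n, l; lia.
  + unfold n. rewrite (pow_add k N). assert (Hp1 := Hkp N). assert (Hp2 := Hkp (p + l)%nat).
    apply Rmult_le_reg_r with (k ^ (p + l)); auto.
    replace (k ^ N * navoid N (p + l) * (c / (k ^ N * k ^ (p + l))) * k ^ (p + l))
      with (navoid N (p + l) * c) by (field; lra).
    apply Rle_trans with (eps * (navoid N (p + l) * (1 + lsum a (seq N p)))); [|nra].
    assert (Hce : c = eps * (c / eps)) by (field; lra).
    assert (navoid N (p + l) * (c / eps) <= navoid N (p + l) * (1 + lsum a (seq N p)))
      by (apply Rmult_le_compat_l; lra).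
    rewrite Hce at 1. nra.
Qed.

End Avoid.

(** * Rational differences that are not d-adic *)

Lemma length_flat_map_le {A B} (h : A -> list B) l c :
  (forall a, In a l -> (length (h a) <= c)%nat) -> (length (flat_map h l) <= length l * c)%nat.
Proof.
induction l as [|a l IH]; simpl; intros H; auto.
rewrite length_app. apply Nat.add_le_mono; auto.
Qed.

Lemma words_spec E l w : In w (words E l) -> length w = l /\ incl w E.
Proof.
revert w; induction l as [|l IH]; intros w H; simpl in H.
- destruct H as [<-|[]]. split; auto. intros a [].
- apply in_flat_map in H as [e [He H]]. apply in_map_iff in H as [w' [<- Hw']].
  destruct (IH w' Hw') as [H1 H2]. split; [simpl; now rewrite H1|].
  intros a [<-|Ha]; auto.
Qed.

Section Differences.

Variables (d : nat) (E : list nat).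
Hypothesis hd : (2 <= d)%nat.
Hypothesis hEsub : forall e, In e E -> (e < d)%nat.
Hypothesis h0 : In 0%nat E.
Hypothesis hdm1 : In (d - 1)%nat E.
Hypothesis hgap : forall a b, In a E -> In b E -> a <> S b.

Definition has_partner (r : R) (a : nat -> nat) : Prop :=
  digits E a /\ exists b u, digits E b /\ isval d a u /\ isval d b (u + r).

(** [q] need not be the reduced denominator. This is what lets the same [q] serve for all later
    differences and keep them at least 1/q in absolute value. *)
Definition nonadic (q : nat) (r : R) : Prop :=
  (exists p, r = IZR p / INR q) /\ forall n z, INR d ^ n * r <> IZR z.

Lemma nonadic_step q r (a b : nat) : (1 <= q)%nat -> nonadic q r ->
  nonadic q (INR d * r - (INR b - INR a)).
Proof.
intros Hq [[p Hp] Hr]. assert (0 < INR q) by (apply lt_0_INR; lia). split.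
- exists (Z.of_nat d * p - (Z.of_nat b - Z.of_nat a) * Z.of_nat q)%Z.
  rewrite minus_IZR, !mult_IZR, minus_IZR, <- !INR_IZR_INZ, Hp. field; lra.
- intros n z Hz. apply (Hr (S n) (z + Z.of_nat d ^ Z.of_nat n * (Z.of_nat b - Z.of_nat a))%Z).
  rewrite plus_IZR, mult_IZR, minus_IZR, <- pow_IZR, <- !INR_IZR_INZ, <- Hz. simpl; ring.
Qed.

(** Both points lie in [0,1], and the differences 1 and -1 are excluded by [nonadic] at exponent
    0. *)
Lemma has_partner_lt_1 q r a : nonadic q r -> has_partner r a -> Rabs r < 1.
Proof.
intros [_ Hr] [Ha [b [u [Hb [Hu Hv]]]]].
assert (H1 := isval_01 d E hd hEsub a u Ha Hu). assert (H2 := isval_01 d E hd hEsub b _ Hb Hv).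
assert (Hr1 := Hr O 1%Z). assert (Hr2 := Hr O (-1)%Z). simpl in Hr1, Hr2. rewrite Rmult_1_l in Hr1, Hr2.
apply Rabs_def1; lra.
Qed.

Lemma has_partner_shift r a : has_partner r a ->
  exists e, In e E /\ has_partner (INR d * r - (INR e - INR (a O))) (shift 1 a).
Proof.
intros [Ha [b [u [Hb [Hu Hv]]]]]. exists (b O). split; [apply Hb|].
split; [now apply digits_shift|]. exists (shift 1 b), (INR d * u - INR (a O)).
split; [now apply digits_shift|]. split; [now apply (isval_tail d a u)|].
apply isval_tail in Hv; auto.
now replace (INR d * u - INR (a O) + (INR d * r - (INR (b O) - INR (a O))))
  with (INR d * (u + r) - INR (b O)) by ring.
Qed.

Lemma close_digits_eq e e' : In e E -> In e' E -> Rabs (INR e - INR e') < 2 -> e = e'.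
Proof.
intros He He' H. apply Rabs_def2 in H.
assert (H1 := hgap _ _ He He'). assert (H2 := hgap _ _ He' He).
assert (Ha : (e < e' + 2)%nat) by (apply INR_lt; rewrite plus_INR; simpl; lra).
assert (Hb : (e' < e + 2)%nat) by (apply INR_lt; rewrite plus_INR; simpl; lra).
lia.
Qed.

(* The gap condition makes the difference after reading one digit of a a function of that digit. *)
Lemma next_difference q r e : (1 <= q)%nat -> nonadic q r -> exists r', nonadic q r' /\
  forall a, has_partner r a -> a O = e -> has_partner r' (shift 1 a).
Proof.
intros Hq Hr. destruct (classic (exists a, has_partner r a /\ a O = e)) as [[a [Ha Hae]]|Hn].
- destruct (has_partner_shift r a Ha) as [b [Hb Hs]].
  exists (INR d * r - (INR b - INR e)). split; [now apply nonadic_step|].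
  intros a' Ha' Hae'. destruct (has_partner_shift r a' Ha') as [b' [Hb' Hs']].
  rewrite Hae in Hs. rewrite Hae' in Hs'.
  assert (H1 := has_partner_lt_1 q _ _ (nonadic_step q r e b Hq Hr) Hs).
  assert (H2 := has_partner_lt_1 q _ _ (nonadic_step q r e b' Hq Hr) Hs').
  apply Rabs_def2 in H1. apply Rabs_def2 in H2.
  assert (Heq : b = b') by (apply close_digits_eq; auto; apply Rabs_def1; lra).
  now rewrite Heq.
- exists r. split; auto. intros a Ha Hae. exfalso; apply Hn; now exists a.
Qed.

Lemma next_difference_word q w : (1 <= q)%nat -> forall r, nonadic q r -> exists r', nonadic q r' /\
  forall a, has_partner r a -> prefix a (length w) = w -> has_partner r' (shift (length w) a).
Proof.
intros Hq. induction w as [|e w IH]; intros r Hr.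
- exists r. split; auto.
- destruct (next_difference q r e Hq Hr) as [r1 [Hr1 H1]].
  destruct (IH r1 Hr1) as [r2 [Hr2 H2]]. exists r2. split; auto.
  intros a Ha Hp. simpl length in Hp |- *. rewrite prefix_S in Hp. injection Hp as He Hp.
  exact (H2 _ (H1 a Ha He) Hp).
Qed.

(* If every first digit is possible then so are 0 and d - 1, which forces |d r| < 1 and equal first
   digits, so r is multiplied by d; this cannot go on. *)
Lemma forbidden_word q l : (1 <= q)%nat -> forall r, nonadic q r -> 1 < Rabs r * INR d ^ l ->
  exists w, In w (words E l) /\ forall a, has_partner r a -> prefix a l <> w.
Proof.
intros Hq. assert (HD : 0 < INR d) by (apply lt_0_INR; lia).
induction l as [|l IH]; intros r Hr Hl.
- exists nil. split; [now left|]. intros a Ha _. apply has_partner_lt_1 with (q := q) in Ha; auto.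
  simpl in Hl. lra.
- destruct (classic (exists e, In e E /\ forall a, has_partner r a -> a O <> e)) as [[e [He Hna]]|Hall].
  + exists (prefix (fun i => if Nat.eqb i 0 then e else 0%nat) (S l)). split.
    * apply prefix_words. intros i. destruct (Nat.eqb i 0); auto.
    * intros a Ha. rewrite !prefix_S. intros Heq. injection Heq as Heq _. now apply (Hna a Ha).
  + assert (Hstep : forall a, has_partner r a -> exists b, In b E /\
       has_partner (INR d * r - (INR b - INR (a O))) (shift 1 a) /\
       -1 < INR d * r - (INR b - INR (a O)) < 1).
    { intros a Ha. destruct (has_partner_shift r a Ha) as [b [Hb Hs]]. exists b. split; auto. split; auto.
      assert (H := has_partner_lt_1 q _ _ (nonadic_step q r (a O) b Hq Hr) Hs).
      apply Rabs_def2 in H; lra. }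
    assert (Hex : forall e, In e E -> exists a, has_partner r a /\ a O = e).
    { intros e He. apply NNPP; intros Hn. apply Hall. exists e. split; auto.
      intros a Ha Hae. apply Hn. now exists a. }
    assert (Hdr : -1 < INR d * r < 1).
    { destruct (Hex _ h0) as [a [Ha Ha0]]. destruct (Hex _ hdm1) as [a' [Ha' Ha0']].
      destruct (Hstep a Ha) as [b [Hb [_ Hlt]]]. destruct (Hstep a' Ha') as [b' [Hb' [_ Hlt']]].
      rewrite Ha0 in Hlt. rewrite Ha0' in Hlt'. simpl in Hlt. assert (HB := pos_INR b).
      assert (HB' : INR b' <= INR (d - 1)) by (apply le_INR; specialize (hEsub _ Hb'); lia). lra. }
    assert (Hdr' : nonadic q (INR d * r)).
    { replace (INR d * r) with (INR d * r - (INR 0 - INR 0)) by ring. now apply nonadic_step. }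
    destruct (IH (INR d * r) Hdr') as [w [Hw1 Hw2]].
    { rewrite Rabs_mult, (Rabs_right (INR d)) by lra. simpl in Hl. lra. }
    exists (0%nat :: w). split.
    * simpl. apply in_flat_map. exists 0%nat. split; auto. now apply in_map.
    * intros a Ha. rewrite prefix_S. intros Heq. injection Heq as _ Heq.
      destruct (Hstep a Ha) as [b [Hb [Hs Hlt]]].
      assert (Hab : b = a O) by (apply close_digits_eq; auto; [apply Ha | apply Rabs_def1; lra]).
      rewrite Hab in Hs. apply (Hw2 (shift 1 a)); auto.
      now replace (INR d * r) with (INR d * r - (INR (a O) - INR (a O))) by ring.
Qed.

(** Each block of [l] digits misses at least one word. The difference after the block depends only
    on the block and is again nonadic with denominator [q], so the count restarts. *)
Lemma partner_prefixes q l : (1 <= q)%nat ->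
  (forall r, nonadic q r -> exists w, In w (words E l) /\ forall a, has_partner r a -> prefix a l <> w) ->
  forall n r, nonadic q r -> exists W, (length W <= (length E ^ l - 1) ^ n)%nat /\
    forall a, has_partner r a -> In (prefix a (n * l)) W.
Proof.
intros Hq Hforb. induction n as [|n IH]; intros r Hr.
- exists (nil :: nil). split; [simpl; lia|]. intros; now left.
- destruct (Hforb r Hr) as [w0 [Hw0 Hna]].
  set (ws := remove (list_eq_dec Nat.eq_dec) w0 (words E l)).
  destruct (choice (fun w W => In w ws -> (length W <= (length E ^ l - 1) ^ n)%nat /\
     forall a, has_partner r a -> prefix a l = w -> In (prefix (shift l a) (n * l)) W)) as [W HW].
  { intros w. destruct (next_difference_word q w Hq r Hr) as [r' [Hr' Hs]].
    destruct (IH r' Hr') as [W [HW1 HW2]]. exists W. intros Hin. split; auto.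
    apply in_remove in Hin as [Hin _]. apply words_spec in Hin as [Hlen _].
    intros a Ha Hp. apply HW2. rewrite <- Hlen. apply Hs; auto. now rewrite Hlen. }
  exists (flat_map (fun w => map (app w) (W w)) ws). split.
  + apply Nat.le_trans with (length ws * (length E ^ l - 1) ^ n)%nat.
    * apply length_flat_map_le. intros w Hw. rewrite length_map. now apply HW.
    * assert (Hlt := remove_length_lt (list_eq_dec Nat.eq_dec) (words E l) w0 Hw0).
      fold ws in Hlt. rewrite length_words in Hlt.
      simpl. apply Nat.mul_le_mono_r. lia.
  + intros a Ha. simpl. rewrite prefix_app. apply in_flat_map. exists (prefix a l).
    assert (Hin : In (prefix a l) ws).
    { apply in_in_remove; [now apply Hna | apply prefix_words, Ha]. }
    split; auto. apply in_map. now apply HW.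
Qed.

(** A nonadic difference is at least 1/q in absolute value and d^(q+1) > q, so blocks of length
    [S q] always have a forbidden word. The cost of the cover is then multiplied by at most (k^l -
    1)/k^l per block. *)
Lemma nonadic_difference_null (f : R -> R) q r : nonneg_gauge f -> (1 <= q)%nat ->
  (1 < length E)%nat -> (forall n, f (/ INR d ^ n) <= / INR (length E) ^ n) -> nonadic q r ->
  Hbound f (fun v => Jset d E v /\ Jset d E (v + r)) 0.
Proof.
intros Hf Hq Hcard Hfk Hr eps eta He Heta. set (l := S q).
assert (HD : 1 < INR d) by (apply (lt_INR 1); lia).
assert (Hforb : forall r, nonadic q r ->
   exists w, In w (words E l) /\ forall a, has_partner r a -> prefix a l <> w).
{ intros r' Hr'. apply (forbidden_word q); auto. destruct Hr' as [[p Hp] Hn].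
  assert (Hp0 : p <> 0%Z).
  { intros ->. apply (Hn O 0%Z). rewrite Hp. unfold Rdiv; ring. }
  assert (Hqp : 0 < INR q) by (apply lt_0_INR; lia).
  rewrite Hp. unfold Rdiv. rewrite Rabs_mult, Rabs_inv, (Rabs_right (INR q)) by lra.
  assert (Hp1 : 1 <= Rabs (IZR p)) by (rewrite <- abs_IZR; apply IZR_le; lia).
  assert (Hql : INR q < INR d ^ l).
  { rewrite <- pow_INR. apply lt_INR. unfold l.
    apply Nat.lt_trans with (S q); [lia|]. apply Nat.pow_gt_lin_r; lia. }
  apply Rmult_lt_reg_l with (INR q); auto.
  replace (INR q * (Rabs (IZR p) * / INR q * INR d ^ l)) with (Rabs (IZR p) * INR d ^ l) by (field; lra).
  nra. }
set (M := (length E ^ l - 1)%nat). set (K := INR (length E) ^ l).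
assert (HK : 1 <= K) by (apply pow_R1_Rle, (le_INR 1); lia).
assert (HM : INR M < K).
{ unfold K, M. rewrite <- pow_INR. apply lt_INR.
  assert (length E ^ l <> 0)%nat by (apply Nat.pow_nonzero; lia). lia. }
destruct (pow_lt_1_zero (INR M / K)) with (y := eps) as [n0 Hn0]; auto.
{ rewrite Rabs_right.
  - apply Rmult_lt_reg_r with K; [lra|]. unfold Rdiv. rewrite Rmult_assoc, Rinv_l by lra. lra.
  - apply Rle_ge, Rmult_le_pos; [apply pos_INR | left; apply Rinv_0_lt_compat; lra]. }
destruct (inv_pow_small (INR d) eta HD Heta) as [n1 Hn1].
set (n := Nat.max n0 n1).
destruct (partner_prefixes q l Hq Hforb n r Hr) as [W [HW1 HW2]].
apply (cylinder_cover d E f eta _ _ (n * l) W); auto.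
- intros v [[a [Ha Hva]] [b [Hb Hvb]]]. exists a. split; auto. split; auto.
  apply HW2. split; auto. now exists b, v.
- apply Hn1. unfold n, l. nia.
- specialize (Hn0 n ltac:(unfold n; lia)). apply Rabs_def2 in Hn0 as [Hn0 _].
  assert (HE : 1 < INR (length E)) by (apply (lt_INR 1); lia).
  assert (HKn : 0 < K ^ n) by (apply pow_lt; lra).
  apply Rle_trans with (INR M ^ n * / K ^ n).
  + apply Rmult_le_compat.
    * apply pos_INR.
    * apply Hf, Rinv_0_lt_compat, pow_lt; lra.
    * rewrite <- pow_INR. now apply le_INR.
    * unfold K. rewrite <- pow_mult, Nat.mul_comm. apply Hfk.
  + rewrite <- pow_inv, <- Rpow_mult_distr. unfold Rdiv in Hn0. lra.
Qed.

End Differences.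

(** * Intrinsic approximation in a translate *)

Lemma Hbound_empty f (Q : R -> Prop) : (forall x, ~ Q x) -> Hbound f Q 0.
Proof.
intros HQ eps eta He Heta. exists (fun _ => (0, 0)). simpl. split; [|split].
- intros; lra.
- intros x Hx; now elim (HQ x).
- intros n. rewrite lsum_const, fcost_0. lra.
Qed.

Lemma lsum_seq_shift (phi : nat -> R) s n : lsum (fun j => phi (s + j)%nat) (seq 0 n) = lsum phi (seq s n).
Proof. induction n as [|n IH]; auto. rewrite !lsum_seq_S, IH. reflexivity. Qed.

Lemma least_scale (d : nat) t : (2 <= d)%nat -> 0 < t ->
  exists g, / INR d ^ g <= t /\ (g = O \/ t < INR d * / INR d ^ g).
Proof.
intros Hd Ht. assert (HD : 1 < INR d) by (apply (lt_INR 1); lia).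
destruct (inv_pow_small (INR d) t HD Ht) as [n Hn]. specialize (Hn n (le_n n)).
induction n as [|n IH].
- exists O; auto.
- destruct (Rle_lt_dec (/ INR d ^ n) t) as [H|H]; auto.
  exists (S n). split; auto. right. simpl. rewrite Rinv_mult, <- Rmult_assoc, Rinv_r by lra. lra.
Qed.

Lemma Rpower_gt_0 x y : 0 < Rpower x y.
Proof. apply exp_pos. Qed.

Lemma Rpower_inv x y : 0 < x -> Rpower (/ x) y = / Rpower x y.
Proof.
intros Hx. unfold Rpower. rewrite ln_Rinv by auto. rewrite <- exp_Ropp. f_equal; ring.
Qed.

Lemma Rpower_pow_l x s n : 0 < x -> Rpower (x ^ n) s = Rpower x s ^ n.
Proof.
intros Hx. rewrite <- Rpower_pow, Rpower_mult, Rmult_comm, <- Rpower_mult, Rpower_pow; auto.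
apply Rpower_gt_0.
Qed.

Section Approximation.

Variables (d : nat) (E : list nat).
Hypothesis hd : prime (Z.of_nat d).
Hypothesis hEsub : forall e, In e E -> (e < d)%nat.
Hypothesis hE : NoDup E.
Hypothesis hcard : (1 < length E)%nat.
Hypothesis h0 : In 0%nat E.
Hypothesis hdm1 : In (d - 1)%nat E.
Hypothesis hgap : forall a b, In a E -> In b E -> a <> S b.

Local Notation k := (INR (length E)).

Lemma d_ge_2 : (2 <= d)%nat.
Proof. clear - hd. assert (H := prime_ge_2 _ hd). lia. Qed.

Lemma k_ge_2 : 2 <= k.
Proof. apply (le_INR 2); lia. Qed.

(** Modulo d the difference of the numerators is [y m - a m], which is nonzero and smaller than d in
    absolute value. As d is prime, coprimality to d follows, hence to its powers. *)
Lemma rel_prime_difference y a m : digits E y -> digits E a -> y m <> a m ->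
  Z.gcd (numer d y (S m) - numer d a (S m)) (Z.of_nat (d ^ S m)) = 1%Z.
Proof.
intros Hy Ha Hne. apply Zgcd_1_rel_prime. rewrite Nat2Z.inj_pow.
apply rel_prime_Zpower_r; [lia|]. apply rel_prime_sym, prime_rel_prime; auto.
intros [z Hz]. simpl numer in Hz.
assert (H1 := hEsub _ (Hy m)). assert (H2 := hEsub _ (Ha m)).
assert (Hdiv : (Z.of_nat (y m) - Z.of_nat (a m) =
  Z.of_nat d * (z - numer d y m + numer d a m))%Z) by lia.
set (t := (z - numer d y m + numer d a m)%Z) in Hdiv.
assert (t = 0)%Z by nia. nia.
Qed.

(** The approximant is [trunc d y (S m) - trunc d a (S m)]: adding it to [x] gives the splice of [y]
    and [a] at [S m], a point of J which agrees with [y] through the block. Its denominator d^(m+1)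
    exceeds [m], so it escapes any finite list. *)
Lemma WA_of_hits a x y v psi : digits E a -> isval d a x -> digits E y -> isval d y v ->
  (forall n, (1 <= n)%nat -> 0 < psi n) ->
  (forall eps N, 0 < eps -> exists m g, (N <= m)%nat /\ / INR d ^ g <= eps * psi (d ^ S m)%nat /\
     y m <> a m /\ forall j, (m < j < S m + g)%nat -> y j = a j) ->
  WA_int (translate (Jset d E) x) psi (v - x).
Proof.
intros Ha Hx Hy Hv Hpsi Hhit. assert (Hd2 := d_ge_2). split.
- exists y. split; auto. now replace (v - x + x) with v by ring.
- intros [_ [eps [He Hna]]]. apply Hna. clear Hna. intros l.
  assert (HN : exists N, forall p q, In (p, q) l -> (q <= N)%nat).
  { induction l as [|[p q] l [N IH]].
    - exists O; intros p q [].
    - exists (Nat.max N q). intros p' q' [Heq|Hin].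
      + injection Heq as -> ->; lia.
      + specialize (IH p' q' Hin); lia. }
  destruct HN as [N HN]. destruct (Hhit eps N He) as [m [g [Hm [Hg [Hne Heq]]]]].
  exists (numer d y (S m) - numer d a (S m))%Z, (d ^ S m)%nat.
  assert (Hgt : (m < d ^ S m)%nat).
  { apply Nat.lt_trans with (S m); [lia | apply Nat.pow_gt_lin_r; lia]. }
  assert (Hpow : 0 < INR d ^ S m) by now apply pow_lt_dim.
  assert (Hfrac : IZR (numer d y (S m) - numer d a (S m)) / INR (d ^ S m) =
     trunc d y (S m) - trunc d a (S m)).
  { rewrite !trunc_numer, pow_INR, minus_IZR by auto. field; lra. }
  assert (Hsp := isval_splice d a y x (S m) Hd2 Hx).
  assert (Hspd : digits E (splice y a (S m))) by (intros i; unfold splice; destruct (Nat.ltb i (S m)); auto).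
  split; [intros Hin; apply HN in Hin; lia|]. split; [lia|]. split; [now apply rel_prime_difference|].
  rewrite Hfrac. split.
  + exists (splice y a (S m)). split; auto.
    now replace (trunc d y (S m) - trunc d a (S m) + x) with (x + trunc d y (S m) - trunc d a (S m)) by ring.
  + replace (v - x - (trunc d y (S m) - trunc d a (S m))) with
      (v - (x + trunc d y (S m) - trunc d a (S m))) by ring.
    apply Rle_trans with (/ INR d ^ (S m + g)).
    * apply (agree_close d E Hd2 hEsub y (splice y a (S m))); auto.
      intros i Hi. unfold splice. destruct (Nat.ltb_spec i (S m)); [auto | apply Heq; lia].
    * rewrite pow_add, Rinv_mult, pow_INR, Rmult_comm. unfold Rdiv. apply Rmult_le_compat_r; auto.
      left; apply Rinv_0_lt_compat; lra.
Qed.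

(** By the gap condition an interval shorter than d^-n meets J inside one cylinder of level n. If
    d^-(n+1) <= l < d^-n, the growth bound gives f(d^-n) <= k f(l); a degenerate interval is given a
    cylinder of cost below [eps]. *)
Lemma cylinder_of_interval f J0 eps a l : 0 < eps -> nonneg_gauge f ->
  (forall s t, 0 < s -> s <= t -> f s <= f t) ->
  (forall e, 0 < e -> exists del, 0 < del /\ forall t, 0 < t < del -> f t < e) ->
  (forall j, f (/ INR d ^ j) <= k * f (/ INR d ^ S j)) ->
  0 <= l <= / INR d ^ S J0 ->
  exists C : list nat, (J0 <= length C)%nat /\ f (/ INR d ^ length C) <= k * fcost f l + eps /\
    forall y v, digits E y -> isval d y v -> a <= v <= a + l ->
      forall j, (j < length C)%nat -> nth j C 0%nat = y j.
Proof.
intros He Hf Hmono Hlim Hgrow Hl. assert (Hd2 := d_ge_2). assert (Hk := k_ge_2).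
assert (HD : 1 < INR d) by (apply (lt_INR 1); lia).
assert (Hp : forall n, 0 < INR d ^ n) by (intros; now apply pow_lt_dim).
assert (Hn : exists n, (J0 <= n)%nat /\ l < / INR d ^ n /\ f (/ INR d ^ n) <= k * fcost f l + eps).
{ destruct (Rlt_le_dec 0 l) as [Hl0|Hl0].
  - destruct (least_scale d l Hd2 Hl0) as [g [Hg1 Hg2]].
    assert (Hinv : forall m n, / INR d ^ n <= / INR d ^ m -> (m <= n)%nat).
    { intros m n H. destruct (le_lt_dec m n) as [|Hlt]; auto. exfalso.
      apply (Rlt_not_le _ _ (Rlt_pow (INR d) n m HD Hlt)).
      rewrite <- (Rinv_inv (INR d ^ m)), <- (Rinv_inv (INR d ^ n)).
      apply Rinv_le_contravar; auto. now apply Rinv_0_lt_compat. }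
    (* One level is lost in passing from [g] to its predecessor [n], which is why [l] is bounded
       with exponent [S J0]. *)
    assert (HgJ : (S J0 <= g)%nat) by (apply Hinv; lra).
    destruct g as [|n]; [lia|]. exists n. split; [lia|]. split.
    + destruct Hg2 as [|Hg2]; [lia|]. simpl in Hg2.
      rewrite Rinv_mult, <- Rmult_assoc, Rinv_r in Hg2 by lra. lra.
    + rewrite fcost_pos by auto. specialize (Hgrow n).
      assert (f (/ INR d ^ S n) <= f l) by (apply Hmono; auto; now apply Rinv_0_lt_compat). nra.
  - replace l with 0 by lra. rewrite fcost_0.
    destruct (Hlim eps He) as [del [Hdel Hlt]].
    destruct (inv_pow_small (INR d) (del / 2) HD) as [n1 Hn1]; [lra|].
    exists (Nat.max J0 n1).
    assert (Hi : 0 < / INR d ^ Nat.max J0 n1) by now apply Rinv_0_lt_compat.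
    split; [lia|]. split; auto.
    specialize (Hn1 (Nat.max J0 n1) ltac:(lia)).
    assert (f (/ INR d ^ Nat.max J0 n1) < eps) by (apply Hlt; lra). lra. }
destruct Hn as [n [Hn1 [Hn2 Hn3]]].
destruct (classic (exists y v, digits E y /\ isval d y v /\ a <= v <= a + l)) as [[y0 [v0 [Hy0 [Hv0 Hi0]]]]|Hno].
- exists (prefix y0 n). rewrite length_prefix. split; auto. split; auto.
  intros y v Hy Hv Hi j Hj. rewrite nth_prefix by auto.
  apply (close_agree d E Hd2 hEsub hgap y0 y v0 v n); auto.
  apply Rle_lt_trans with l; auto. apply Rabs_le; lra.
(* The interval misses J: any word of length [n] will do, the last clause being vacuous. *)
- exists (repeat 0%nat n). rewrite repeat_length. split; auto. split; auto.
  intros y v Hy Hv Hi. exfalso. apply Hno. now exists y, v.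
Qed.

Lemma limsup_not_Hbound f a x (g : nat -> nat -> nat) (Q : R -> Prop) :
  (forall t, 0 < t -> 0 < f t) -> (forall s t, 0 < s -> s <= t -> f s <= f t) ->
  (forall e, 0 < e -> exists del, 0 < del /\ forall t, 0 < t < del -> f t < e) ->
  (forall j, f (/ INR d ^ j) <= k * f (/ INR d ^ S j)) ->
  (forall b, exists j, b <= k ^ j * f (/ INR d ^ j)) ->
  digits E a ->
  (forall s b, exists n, b <= lsum (fun m => k ^ m * f (/ INR d ^ (S m + g s m))) (seq 0 n)) ->
  (forall y v, digits E y -> isval d y v ->
     (forall s, exists m, (s <= m)%nat /\ y m <> a m /\ forall j, (m < j < S m + g s m)%nat -> y j = a j) ->
     Q (v - x)) ->
  forall b, ~ Hbound f Q b.
Proof.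
intros Hpos Hmono Hlim Hgrow Hunb Ha Hdiv HQ b HB. assert (Hd2 := d_ge_2). assert (Hk := k_ge_2).
assert (HD : 1 < INR d) by (apply (lt_INR 1); lia).
assert (Hf : nonneg_gauge f) by (intros t Ht; left; auto).
(* [M] bounds the total load: k times the cost b + 1 of the intervals, plus 2 for the errors 2^-i.
   The level [J0] is such that [k ^ J0 * F J0] exceeds it. *)
set (M := k * (b + 1) + 2). destruct (Hunb (M + 1)) as [J0 HJ0].
assert (Hip : forall n, 0 < / INR d ^ n) by (intros; now apply Rinv_0_lt_compat, pow_lt_dim).
destruct (HB 1 (/ INR d ^ S J0)) as [I [HI1 [HI2 HI3]]]; [lra | auto |].
destruct (choice (fun i C => (J0 <= length C)%nat /\
   f (/ INR d ^ length C) <= k * fcost f (snd (I i)) + (/ 2) ^ i /\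
   forall y v, digits E y -> isval d y v -> fst (I i) + x <= v <= fst (I i) + x + snd (I i) ->
      forall j, (j < length C)%nat -> nth j C 0%nat = y j)) as [C HC].
{ intros i. apply cylinder_of_interval; auto. apply pow_lt; lra. }
destruct (load_ex E C (fun i => f (/ INR d ^ length (C i))) M) as [load [Hl1 [Hl2 [Hl3 Hl4]]]]; auto.
{ intros n. apply Rle_trans with
    (lsum (fun i => k * fcost f (snd (I i)) + (/ 2) ^ i) (seq 0 n)).
  - apply lsum_le. intros i _. apply HC.
  - rewrite lsum_plus, lsum_scal. specialize (HI3 n).
    assert (Hg : lsum (pow (/ 2)) (seq 0 n) <= 2 - 2 * (/ 2) ^ n).
    { clear. induction n as [|n IH]; [simpl; lra|]. rewrite lsum_seq_S, Nat.add_0_l. simpl. lra. }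
    assert (0 < (/ 2) ^ n) by (apply pow_lt; lra). apply (Rmult_le_compat_l k) in HI3; [|lra]. unfold M. lra. }
destruct (limsup_avoids E (fun j => f (/ INR d ^ j)) C load hE Hk) with (x := a) (g := g) (J0 := J0)
  as [y [Hy1 [Hy2 Hy3]]]; auto.
- intros j. apply Hmono; auto. simpl. rewrite Rinv_mult.
  assert (/ INR d <= 1) by (rewrite <- Rinv_1; apply Rinv_le_contravar; lra).
  specialize (Hip j). nra.
- intros i; apply HC.
- lra.
- destruct (isval_ex d E Hd2 hEsub y Hy1) as [v Hv].
  destruct (HI2 _ (HQ y v Hy1 Hv Hy3)) as [i Hi].
  destruct (Hy2 i) as [j [Hj Hne]]. apply Hne.
  apply (proj2 (proj2 (HC i)) y v); auto. lra.
Qed.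

(** * The critical exponent *)

Variable delta : R.
Hypothesis hdelta : Rpower (INR d) delta = k.

Lemma D_gt_1 : 1 < INR d.
Proof. apply (lt_INR 1). assert (H := d_ge_2). lia. Qed.

Lemma delta_pos : 0 < delta.
Proof.
assert (HD := D_gt_1). assert (Hk := k_ge_2). apply Rnot_le_lt; intros Hn.
assert (H : Rpower (INR d) delta <= Rpower (INR d) 0) by (apply Rle_Rpower; lra).
rewrite Rpower_O in H by lra. lra.
Qed.

Lemma Rpower_pow_d n : Rpower (INR d ^ n) delta = k ^ n.
Proof. assert (HD := D_gt_1). rewrite Rpower_pow_l, hdelta; lra. Qed.

Lemma Rpower_inv_pow_d n : Rpower (/ INR d ^ n) delta = / k ^ n.
Proof. rewrite Rpower_inv, Rpower_pow_d; auto. apply pow_lt_dim, d_ge_2. Qed.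

(** The doubling property that allows [eps * psi] in place of [psi] in the divergent sum. *)
Lemma gauge_scale f : (forall s t, 0 < s -> s <= t -> Rpower t (- delta) * f t <= Rpower s (- delta) * f s) ->
  forall c s, 1 <= c -> 0 < s -> f (c * s) <= Rpower c delta * f s.
Proof.
intros H c s Hc Hs. specialize (H s (c * s) Hs ltac:(nra)).
rewrite !Rpower_Ropp, <- Rpower_mult_distr in H by lra.
assert (H1 := Rpower_gt_0 c delta). assert (H2 := Rpower_gt_0 s delta).
apply Rmult_le_compat_l with (r := Rpower c delta * Rpower s delta) in H; [|nra].
replace (Rpower c delta * Rpower s delta * (/ (Rpower c delta * Rpower s delta) * f (c * s)))
  with (f (c * s)) in H by (field; lra).
replace (Rpower c delta * Rpower s delta * (/ Rpower s delta * f s)) with (Rpower c delta * f s) in H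
  by (field; lra).
exact H.
Qed.

Lemma exceptional_null (N : R -> Prop) :
  (forall v, N v -> exists p q, (1 <= q)%nat /\ nonadic d q (IZR p / INR q) /\
     Jset d E v /\ Jset d E (v + IZR p / INR q)) ->
  Hbound (fun t => Rpower t delta) N 0.
Proof.
intros HN. set (f := fun t => Rpower t delta).
assert (Hf : nonneg_gauge f) by (intros t _; left; apply Rpower_gt_0).
(* An integer is coded as a difference of two naturals, so that the fractions run through a
   sequence. *)
set (num := fun n => (Z.of_nat (fst (of_nat (fst (of_nat n)))) - Z.of_nat (snd (of_nat (fst (of_nat n)))))%Z).
set (den := fun n => snd (of_nat n)).
set (T := fun n v => (1 <= den n)%nat /\ nonadic d (den n) (IZR (num n) / INR (den n)) /\
   Jset d E v /\ Jset d E (v + IZR (num n) / INR (den n))).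
apply (Hbound_union f N T Hf).
- intros v Hv. destruct (HN v Hv) as [p [q H]].
  exists (to_nat (to_nat (Z.to_nat p, Z.to_nat (- p)), q)).
  assert (Hn : num (to_nat (to_nat (Z.to_nat p, Z.to_nat (- p)), q)) = p).
  { unfold num. rewrite cancel_of_to; cbn [fst]. rewrite cancel_of_to; cbn [fst snd]. lia. }
  assert (Hq : den (to_nat (to_nat (Z.to_nat p, Z.to_nat (- p)), q)) = q).
  { unfold den. now rewrite cancel_of_to. }
  unfold T. rewrite Hn, Hq. exact H.
- intros n. destruct (classic ((1 <= den n)%nat /\ nonadic d (den n) (IZR (num n) / INR (den n)))) as [[H1 H2]|H].
  + apply (Hbound_translate f _ (fun v => Jset d E v /\ Jset d E (v + IZR (num n) / INR (den n))) 0).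
    * intros y [_ [_ Hy]]. now rewrite Rminus_0_r.
    * apply (nonadic_difference_null d E d_ge_2 hEsub h0 hdm1 hgap f (den n)); auto.
      intros j. unfold f. rewrite Rpower_inv_pow_d. lra.
  + apply Hbound_empty. intros v [H1 [H2 _]]. now apply H.
Qed.

(** Clearing denominators, q divides p d^n, hence d^n by coprimality, and d is prime. *)
Lemma adic_denominator p q : (1 <= q)%nat -> Z.gcd p (Z.of_nat q) = 1%Z ->
  ~ nonadic d q (IZR p / INR q) -> exists j, q = (d ^ j)%nat.
Proof.
intros Hq Hgcd Hn.
assert (Hex : exists n z, INR d ^ n * (IZR p / INR q) = IZR z).
{ apply NNPP; intros H. apply Hn. split; [now exists p|]. intros n z Hz. apply H. now exists n, z. }
destruct Hex as [n [z Hz]].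
assert (Hqp : 0 < INR q) by (apply lt_0_INR; lia).
assert (HZ : (p * Z.of_nat d ^ Z.of_nat n = z * Z.of_nat q)%Z).
{ apply eq_IZR. rewrite !mult_IZR, <- pow_IZR, <- !INR_IZR_INZ, <- Hz. field; lra. }
assert (Hdiv : (Z.of_nat q | Z.of_nat d ^ Z.of_nat n)%Z).
{ apply Gauss with p; [exists z; lia|]. apply rel_prime_sym. now apply Zgcd_1_rel_prime. }
destruct (Zdivide_power_2 (Z.of_nat q) (Z.of_nat d) (Z.of_nat n)) as [m Hm]; auto; try lia.
destruct (Z.neg_nonneg_cases m) as [Hneg|Hpos].
- rewrite Z.pow_neg_r in Hm by auto. lia.
- exists (Z.to_nat m). apply Nat2Z.inj. rewrite Nat2Z.inj_pow, Z2Nat.id; auto.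
Qed.

(* Two points of [0,1] differing by an integer differ by -1, 0 or 1; this is the role of sg. *)
Lemma adic_points a x j p : digits E a -> isval d a x ->
  Jset d E (IZR p / INR (d ^ j) + x) ->
  exists w sg, In w (words E j) /\ In sg (-1 :: 0 :: 1 :: nil) /\
    IZR p / INR (d ^ j) = trunc d (fun i => nth i w 0%nat) j - trunc d a j + sg / INR d ^ j.
Proof.
intros Ha Hx [b [Hb Hv]]. assert (Hd2 := d_ge_2). assert (Hp : 0 < INR d ^ j) by now apply pow_lt_dim.
rewrite pow_INR in *.
assert (H1 := trunc_approx d E Hd2 hEsub a x j Ha Hx). assert (H2 := trunc_approx d E Hd2 hEsub b _ j Hb Hv).
set (sg := (p - numer d b j + numer d a j)%Z).
assert (Hsg : IZR sg / INR d ^ j = IZR p / INR d ^ j - trunc d b j + trunc d a j).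
{ unfold sg. rewrite plus_IZR, minus_IZR, !trunc_numer by auto. field; lra. }
exists (prefix b j), (IZR sg). split; [now apply prefix_words|]. split.
- assert (Hr : -1 <= IZR sg <= 1).
  { assert (Hs : IZR sg = INR d ^ j * (IZR sg / INR d ^ j)) by (field; lra).
    assert (Hi : INR d ^ j * / INR d ^ j = 1) by (field; lra).
    assert (- / INR d ^ j <= IZR sg / INR d ^ j <= / INR d ^ j) by lra. nra. }
  destruct Hr as [Hr1 Hr2]. apply le_IZR in Hr1. apply le_IZR in Hr2.
  assert (sg = -1 \/ sg = 0 \/ sg = 1)%Z as [->|[->| ->]] by lia; simpl; auto.
- rewrite Hsg, (trunc_ext d (fun i => nth i (prefix b j) 0%nat) b); [ring|].
  intros; now apply nth_prefix.
Qed.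

(** Contains every fraction in [-1,1] with positive denominator at most [n], reduced or not.
    Rationals of the translate lie in [-1,1], so those outside the list have large denominators. *)
Definition bounded_fractions (n : nat) : list (Z * nat) :=
  flat_map (fun q => map (fun i => (Z.of_nat i - Z.of_nat q, q)%Z) (seq 0 (2 * q + 1))) (seq 0 (S n)).

Lemma in_bounded_fractions n p q : (q <= n)%nat -> (Z.abs p <= Z.of_nat q)%Z -> In (p, q) (bounded_fractions n).
Proof.
intros Hq Hp. apply in_flat_map. exists q. split; [apply in_seq; lia|].
apply in_map_iff. exists (Z.to_nat (p + Z.of_nat q)). split; [f_equal; lia | apply in_seq; lia].
Qed.

(** A well approximable point is approximable with eps = 1/2, so intervals of length exactly
    psi(q)/q centred at the rationals suffice and no doubling of [f] is used. At denominator d^j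
    there are at most 3 k^j centres, 3 being the number of values of [sg]. *)
Lemma WA_null_of_convergence x psi f : Jset d E x ->
  (forall p q, (1 <= q)%nat -> nonadic d q (IZR p / INR q) -> ~ Jset d E (x + IZR p / INR q)) ->
  (forall n, (1 <= n)%nat -> 0 < psi n) ->
  (forall t, 0 < t -> 0 < f t) -> (forall s t, 0 < s -> s <= t -> f s <= f t) ->
  (exists l, infinite_sum (fun n => f (psi (d ^ S n)%nat / INR (d ^ S n)) * Rpower (INR (d ^ S n)) delta) l) ->
  Hbound f (WA_int (translate (Jset d E) x) psi) 0.
Proof.
intros [a [Ha Hx]] Hgen Hpsi Hpos Hmono [l0 Hl0] eps eta He Heta.
assert (Hd2 := d_ge_2). assert (Hk := k_ge_2).
assert (Hf : nonneg_gauge f) by (intros t Ht; left; auto).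
set (rho := fun n => psi (d ^ n)%nat / INR (d ^ n)).
assert (Hq1 : forall n, (1 <= d ^ n)%nat) by (intros n; assert (d ^ n <> 0)%nat by (apply Nat.pow_nonzero; lia); lia).
assert (Hrho : forall n, 0 < rho n).
{ intros n. apply Rdiv_lt_0_compat; [apply Hpsi; auto | apply lt_0_INR; specialize (Hq1 n); lia]. }
set (term := fun n => f (rho (S n)) * k ^ S n).
assert (Hterm : infinite_sum term l0).
{ intros e Hee. destruct (Hl0 e Hee) as [N HN]. exists N. intros n Hn.
  rewrite (sum_eq term (fun n => f (psi (d ^ S n)%nat / INR (d ^ S n)) * Rpower (INR (d ^ S n)) delta)); auto.
  intros i _. unfold term, rho. now rewrite (pow_INR d (S i)), Rpower_pow_d. }
assert (Htpos : forall n, 0 <= term n).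
{ intros n. apply Rmult_le_pos; [left; auto | apply pow_le; lra]. }
assert (Hfe := Hpos eta Heta).
(* The bound [eps / 3] allows for the values of [sg]. The bound [f eta / 2] keeps the intervals
   shorter than [eta], as a longer one would contribute at least [f eta] to the tail. *)
destruct (infinite_sum_tail term l0 (Rmin (eps / 3) (f eta / 2)) Htpos Hterm) as [N HN].
{ apply Rmin_glb_lt; lra. }
assert (Hm1 := Rmin_l (eps / 3) (f eta / 2)). assert (Hm2 := Rmin_r (eps / 3) (f eta / 2)).
assert (Hsmall : forall n, (N <= n)%nat -> rho (S n) <= eta).
{ intros n Hn. specialize (HN n 1%nat Hn). simpl in HN. apply Rnot_lt_le; intros Hlt.
  assert (f eta <= f (rho (S n))) by (apply Hmono; lra).
  assert (1 <= k ^ S n) by (apply pow_R1_Rle; lra). unfold term in HN. nra. }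
set (ival := fun j w sg => (trunc d (fun i => nth i w 0%nat) j - trunc d a j + sg / INR d ^ j - rho j / 2, rho j)).
apply (interval_cover_lists f eta _ (0 + eps) (fun n => flat_map (fun w => map (ival (S (N + n)) w)
   (-1 :: 0 :: 1 :: nil)) (words E (S (N + n))))); auto.
- intros n pr Hin. apply in_flat_map in Hin as [w [_ Hin]]. apply in_map_iff in Hin as [sg [<- _]].
  simpl. split; [left; auto | apply Hsmall; lia].
- intros y [Hy Hnb].
  assert (Hap : int_approx (translate (Jset d E) x) (fun q => / 2 * psi q) y).
  { apply NNPP; intros H. apply Hnb. split; auto. exists (/ 2). split; [lra | auto]. }
  destruct (Hap (bounded_fractions (d ^ N))) as [p [q [Hnin [Hq [Hgcd [HJ Hclose]]]]]].
  destruct (adic_denominator p q Hq Hgcd) as [j Hj].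
  { intros Hna. apply (Hgen p q Hq Hna). unfold translate in HJ. now rewrite Rplus_comm. }
  subst q. unfold translate in HJ.
  assert (HjN : (N < j)%nat).
  { apply Nat.nle_gt; intros Hle. apply Hnin, in_bounded_fractions.
    - apply Nat.pow_le_mono_r; lia.
    - destruct HJ as [b [Hb Hv]].
      assert (H1 := isval_01 d E Hd2 hEsub a x Ha Hx). assert (H2 := isval_01 d E Hd2 hEsub b _ Hb Hv).
      assert (Hqp : 0 < INR (d ^ j)) by (apply lt_0_INR; specialize (Hq1 j); lia).
      assert (Hs : IZR p = INR (d ^ j) * (IZR p / INR (d ^ j))) by (field; lra).
      assert (Hb1 : - INR (d ^ j) <= IZR p <= INR (d ^ j)) by nra.
      rewrite INR_IZR_INZ, <- opp_IZR in Hb1. destruct Hb1 as [Hb1 Hb2].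
      apply le_IZR in Hb1. apply le_IZR in Hb2. lia. }
  destruct (adic_points a x j p Ha Hx HJ) as [w [sg [Hw [Hsg Heq]]]].
  exists (j - S N)%nat, (ival j w sg). replace (S (N + (j - S N))) with j by lia. split.
  + apply in_flat_map. exists w. split; auto. now apply in_map.
  + rewrite Heq in Hclose.
    replace (/ 2 * psi (d ^ j)%nat / INR (d ^ j)) with (rho j / 2) in Hclose by (unfold rho, Rdiv; ring).
    assert (Hc2 := Hclose). rewrite <- Rabs_Ropp in Hc2.
    apply (Rle_trans _ _ _ (Rle_abs _)) in Hclose. apply (Rle_trans _ _ _ (Rle_abs _)) in Hc2.
    simpl. lra.
- intros n. rewrite (lsum_ext _ (fun j => 3 * term (N + j)%nat)).
  + rewrite lsum_scal, lsum_seq_shift. specialize (HN N n (le_n N)). lra.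
  + intros i _. rewrite lsum_flat_map.
    rewrite (lsum_ext _ (fun _ => 3 * f (rho (S (N + i))))).
    * rewrite lsum_const, INR_length_words. unfold term. ring.
    * intros w _. rewrite lsum_map. simpl. rewrite fcost_pos by auto. ring.
Qed.


(** [g s m] is the least block length giving accuracy psi/(s+1) at denominator d^(m+1); the second
    clause records minimality, from which the divergence is transferred. *)
Lemma scales_ex psi : (forall n, (1 <= n)%nat -> 0 < psi n) ->
  exists g : nat -> nat -> nat, forall s m,
    / INR d ^ g s m <= / INR (S s) * psi (d ^ S m)%nat /\
    (g s m = O \/ psi (d ^ S m)%nat < INR d * INR (S s) * / INR d ^ g s m).
Proof.
intros Hpsi. assert (Hd2 := d_ge_2).
destruct (choice (fun (p : nat * nat) g => / INR d ^ g <= / INR (S (fst p)) * psi (d ^ S (snd p))%nat /\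
    (g = O \/ psi (d ^ S (snd p))%nat < INR d * INR (S (fst p)) * / INR d ^ g))) as [g Hg].
- intros [s m]; cbn [fst snd]. assert (Hs : 0 < INR (S s)) by (apply lt_0_INR; lia).
  assert (Hq : 0 < psi (d ^ S m)%nat).
  { apply Hpsi. assert (d ^ S m <> 0)%nat by (apply Nat.pow_nonzero; lia). lia. }
  destruct (least_scale d (/ INR (S s) * psi (d ^ S m)%nat)) as [g [Hg1 Hg2]]; auto.
  { apply Rmult_lt_0_compat; auto. now apply Rinv_0_lt_compat. }
  exists g. split; auto. destruct Hg2 as [|Hg2]; auto. right.
  apply (Rmult_lt_compat_l (INR (S s))) in Hg2; auto.
  rewrite <- Rmult_assoc, Rinv_r, Rmult_1_l in Hg2 by lra. lra.
- exists (fun s m => g (s, m)). intros s m. apply (Hg (s, m)).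
Qed.

Lemma WA_of_all_scales a x y v psi g : digits E a -> isval d a x -> digits E y -> isval d y v ->
  (forall n, (1 <= n)%nat -> 0 < psi n) ->
  (forall s m, / INR d ^ g s m <= / INR (S s) * psi (d ^ S m)%nat) ->
  (forall s N, exists s' m, (s <= s')%nat /\ (N <= m)%nat /\ hits a (g s') y m) ->
  WA_int (translate (Jset d E) x) psi (v - x).
Proof.
intros Ha Hx Hy Hv Hpsi Hg Hhit. apply (WA_of_hits a x y v psi); auto.
intros eps N He. destruct (archimed_cor1 eps He) as [s [Hs1 Hs2]].
destruct (Hhit s N) as [s' [m [Hs' [Hm [Hne Heq]]]]]. exists m, (g s' m). split; auto. split; auto.
apply Rle_trans with (1 := Hg s' m). apply Rmult_le_compat_r.
- left; apply Hpsi. assert (Hd2 := d_ge_2).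
  assert (d ^ S m <> 0)%nat by (apply Nat.pow_nonzero; lia). lia.
- apply Rle_trans with (/ INR s); [|lra]. apply Rinv_le_contravar; [now apply lt_0_INR | apply le_INR; lia].
Qed.

Lemma sums_unbounded (h t : nat -> R) c0 c : 0 < c0 -> 0 <= c ->
  (forall m, 0 <= h m) -> (forall m, 0 <= t m) -> (forall m, c0 <= h m \/ t m <= c * h m) ->
  ~ (exists l, infinite_sum t l) -> forall b, exists n, b <= lsum h (seq 0 n).
Proof.
intros Hc0 Hc Hh Ht Hor Hdiv b. apply NNPP; intros Hn. apply Hdiv.
destruct (sum_comparison h t c0 c b Hc0 Hc Hh Hor) as [b' Hb'].
- intros n. apply Rnot_lt_le; intros Hlt. apply Hn. exists n; lra.
- now apply (bounded_sums_converge t b').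
Qed.

(** * The divergence case *)

Section Divergence.

Variables (x : R) (psi : nat -> R) (f : R -> R).
Hypothesis hx : Jset d E x.
Hypothesis hpsi : forall n, (1 <= n)%nat -> 0 < psi n.
Hypothesis fpos : forall t, 0 < t -> 0 < f t.
Hypothesis fmono : forall s t, 0 < s -> s <= t -> f s <= f t.
Hypothesis hdiv : ~ (exists l, infinite_sum
  (fun n => f (psi (d ^ S n)%nat / INR (d ^ S n)) * Rpower (INR (d ^ S n)) delta) l).

Lemma term_nonneg n : 0 <= f (psi (d ^ S n)%nat / INR (d ^ S n)) * Rpower (INR (d ^ S n)) delta.
Proof.
assert (Hd2 := d_ge_2). assert (d ^ S n <> 0)%nat by (apply Nat.pow_nonzero; lia).
apply Rmult_le_pos; left; [|apply Rpower_gt_0].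
apply fpos, Rdiv_lt_0_compat; [apply hpsi; lia | apply lt_0_INR; lia].
Qed.

Lemma WA_conull c : 0 < c -> (forall t, 0 < t <= 1 -> f t <= c * Rpower t delta) ->
  Hbound f (fun v => Jset d E v /\ ~ WA_int (translate (Jset d E) x) psi (v - x)) 0.
Proof.
intros Hc Hfc. destruct hx as [a [Ha Hx]]. assert (Hd2 := d_ge_2). assert (Hk := k_ge_2). assert (HD := D_gt_1).
assert (Hf : nonneg_gauge f) by (intros t Ht; left; auto).
destruct (scales_ex psi hpsi) as [g Hg].
assert (Hgdiv : forall s b, exists n, b <= lsum (fun m => / k ^ g s m) (seq 0 n)).
{ intros s. assert (Hs : 1 <= INR (S s)) by (apply (le_INR 1); lia).
  set (B := INR d * INR (S s)). assert (HB : 1 <= B) by (unfold B; nra).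
  set (P := Rpower B delta). assert (HP : 0 < P) by apply Rpower_gt_0.
  apply (sums_unbounded _ _ (Rmin 1 (/ P)) (c * P)) with (6 := hdiv).
  - apply Rmin_glb_lt; [lra | now apply Rinv_0_lt_compat].
  - nra.
  - intros m. left. apply Rinv_0_lt_compat, pow_lt; lra.
  - apply term_nonneg.
  (* If the block is empty then [/ k ^ g s m] is 1. Otherwise, if u/q <= 1, the bound on [f] applies
     and minimality of the block gives [c * P]; if u/q > 1, then u > 1 forces G < B, so
     [/ k ^ g s m] is at least [/ P]. *)
  - intros m. set (q := INR d ^ S m). set (G := INR d ^ g s m).
    assert (Hq : 1 <= q) by (apply pow_R1_Rle; lra).
    assert (HG : 0 < G) by now apply pow_lt_dim.
    assert (HkG : Rpower G delta = k ^ g s m) by apply Rpower_pow_d.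
    assert (HkGp : 0 < k ^ g s m) by (apply pow_lt; lra).
    assert (Hdp := delta_pos).
    assert (Hm1 := Rmin_l 1 (/ P)). assert (Hm2 := Rmin_r 1 (/ P)).
    rewrite !(pow_INR d (S m)), Rpower_pow_d. fold q.
    set (u := psi (d ^ S m)%nat).
    assert (Hu : 0 < u).
    { apply hpsi. assert (d ^ S m <> 0)%nat by (apply Nat.pow_nonzero; lia). lia. }
    destruct (proj2 (Hg s m)) as [H0|Hlt].
    + left. rewrite H0. simpl. rewrite Rinv_1. lra.
    + fold B G u in Hlt. destruct (Rle_lt_dec (u / q) 1) as [Hle|Hgt].
      * right. apply Rle_trans with (c * Rpower (u / q) delta * k ^ S m).
        { apply Rmult_le_compat_r; [apply pow_le; lra|]. apply Hfc. split; auto.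
          apply Rdiv_lt_0_compat; lra. }
        unfold Rdiv. rewrite <- Rpower_mult_distr by (auto; apply Rinv_0_lt_compat; lra).
        rewrite (Rpower_inv q) by lra. unfold q at 1. rewrite Rpower_pow_d.
        replace (c * (Rpower u delta * / k ^ S m) * k ^ S m) with (c * Rpower u delta)
          by (field; apply pow_nonzero; lra).
        rewrite Rmult_assoc. apply Rmult_le_compat_l; [lra|].
        rewrite <- HkG, <- Rpower_inv by auto. unfold P.
        rewrite Rpower_mult_distr by (try lra; now apply Rinv_0_lt_compat).
        apply Rle_Rpower_l; lra.
      * left. apply Rle_trans with (1 := Hm2). apply Rinv_le_contravar; auto.
        rewrite <- HkG. apply Rle_Rpower_l; [lra|]. split; auto. left.
        assert (q < u) by (apply (Rmult_lt_compat_r q) in Hgt; [|lra];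
          unfold Rdiv in Hgt; rewrite Rmult_assoc, Rinv_l in Hgt by lra; lra).
        assert (Hl2 : 1 < B * / G) by lra. apply (Rmult_lt_compat_r G) in Hl2; auto.
        rewrite Rmult_assoc, Rinv_l in Hl2 by lra. lra. }
(* [of_nat n] encodes a scale s and a rank N after which no target of that scale is hit. A point
   outside all these sets hits targets of every scale infinitely often. *)
set (T := fun n v => exists y, digits E y /\ isval d y v /\
   forall m, (snd (of_nat n) <= m)%nat -> ~ hits a (g (fst (of_nat n))) y m).
apply (Hbound_union f _ T Hf).
- intros v [[y [Hy Hv]] HnWA]. apply NNPP; intros Hno. apply HnWA.
  apply (WA_of_all_scales a x y v psi g); auto; [apply Hg|].
  intros s N. apply NNPP; intros Hnm. apply Hno. exists (to_nat (s, N)), y.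
  rewrite cancel_of_to. cbn [fst snd]. split; auto. split; auto.
  intros m Hm Hh. apply Hnm. now exists s, m.
- intros n. apply (eventually_no_hit_null d E a (g (fst (of_nat n))) Hd2 hEsub hE Hk Ha f c 0); auto.
  intros j _. unfold Rdiv. rewrite <- Rpower_inv_pow_d. apply Hfc.
  assert (1 <= INR d ^ j) by (apply pow_R1_Rle; lra).
  split; [apply Rinv_0_lt_compat; lra|]. rewrite <- Rinv_1. apply Rinv_le_contravar; lra.
Qed.

Lemma WA_not_Hbound :
  (forall e, 0 < e -> exists del, 0 < del /\ forall t, 0 < t < del -> f t < e) ->
  (forall s t, 0 < s -> s <= t -> Rpower t (- delta) * f t <= Rpower s (- delta) * f s) ->
  (forall c, exists t, 0 < t <= 1 /\ c < Rpower t (- delta) * f t) ->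
  forall b, ~ Hbound f (WA_int (translate (Jset d E) x) psi) b.
Proof.
intros Hlim Hdec Hunb. destruct hx as [a [Ha Hx]].
assert (Hd2 := d_ge_2). assert (Hk := k_ge_2). assert (HD := D_gt_1).
assert (Hkp : forall n, 0 < k ^ n) by (intros; apply pow_lt; lra).
assert (Hip : forall n, 0 < / INR d ^ n) by (intros; now apply Rinv_0_lt_compat, pow_lt_dim).
assert (HR : forall n, Rpower (/ INR d ^ n) (- delta) = k ^ n).
{ intros n. rewrite Rpower_Ropp, Rpower_inv_pow_d, Rinv_inv. reflexivity. }
assert (HG : forall i j, (i <= j)%nat -> k ^ i * f (/ INR d ^ i) <= k ^ j * f (/ INR d ^ j)).
{ intros i j Hij. rewrite <- !HR. apply Hdec; auto. apply Rinv_le_contravar; [now apply pow_lt_dim|].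
  apply Rle_pow; auto; lra. }
assert (Hgrow : forall j, f (/ INR d ^ j) <= k * f (/ INR d ^ S j)).
{ intros j. apply Rmult_le_reg_l with (k ^ j); auto. specialize (HG j (S j) ltac:(lia)). simpl in *. lra. }
destruct (scales_ex psi hpsi) as [g Hg].
apply (limsup_not_Hbound f a x g); auto.
- intros b. destruct (Hunb b) as [t [[Ht1 Ht2] Hbt]].
  destruct (inv_pow_small (INR d) t HD Ht1) as [n Hn]. exists n. rewrite <- HR.
  apply Rle_trans with (Rpower t (- delta) * f t); [lra|]. apply Hdec; auto.
- intros s. assert (Hs : 1 <= INR (S s)) by (apply (le_INR 1); lia).
  set (B := INR d * INR (S s)). assert (HB : 1 <= B) by (unfold B; nra).
  set (P := Rpower B delta). assert (HP : 0 < P) by apply Rpower_gt_0.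
  assert (Hf1 : 0 < f 1) by (apply fpos; lra).
  (* An empty block leaves k^m f(d^-(m+1)), at least f(1)/k by [HG]. Otherwise [gauge_scale] costs
     the factor [P], and the other factor k comes from k^(m+1) against k^m. *)
  apply (sums_unbounded _ _ (f 1 / k) (k * P)) with (6 := hdiv).
  + apply Rdiv_lt_0_compat; lra.
  + nra.
  + intros m. apply Rmult_le_pos; left; auto.
  + apply term_nonneg.
  + intros m. rewrite !(pow_INR d (S m)), Rpower_pow_d. set (u := psi (d ^ S m)%nat).
    assert (Hq : 0 < INR d ^ S m) by now apply pow_lt_dim.
    destruct (proj2 (Hg s m)) as [H0|Hlt].
    * left. rewrite H0, Nat.add_0_r. apply Rmult_le_reg_l with k; [lra|].
      replace (k * (f 1 / k)) with (f 1) by (field; lra).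
      assert (H := HG 0%nat (S m) ltac:(lia)). simpl in H. rewrite Rinv_1 in H. simpl. lra.
    * right. fold B u in Hlt.
      assert (Hfu : f (u / INR d ^ S m) <= P * f (/ INR d ^ (S m + g s m))).
      { apply Rle_trans with (f (B * / INR d ^ (S m + g s m))).
        - apply fmono.
          + apply Rdiv_lt_0_compat; auto. apply hpsi.
            assert (d ^ S m <> 0)%nat by (apply Nat.pow_nonzero; lia). lia.
          + rewrite pow_add, Rinv_mult, (Rmult_comm (/ INR d ^ S m)), <- Rmult_assoc. unfold Rdiv.
            apply Rmult_le_compat_r; [left; auto | lra].
        - apply gauge_scale; auto. }
      apply (Rmult_le_compat_r (k ^ S m)) in Hfu; [|left; auto]. simpl pow at 2 in Hfu.
      change (k ^ S m) with (k * k ^ m) in *. lra.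
- intros y v Hy Hv Hhit. apply (WA_of_all_scales a x y v psi g); auto; [apply Hg|].
  intros s N. destruct (Hhit (Nat.max s N)) as [m [Hm Hh]].
  exists (Nat.max s N), m. split; [lia|]. split; [lia | exact Hh].
Qed.

End Divergence.

End Approximation.

(** * The Hausdorff dimension *)

Lemma Rpower_le_exponent t s s' : 0 < t <= 1 -> s <= s' -> Rpower t s' <= Rpower t s.
Proof.
intros Ht Hs. assert (Hl : ln t <= 0).
{ rewrite <- ln_1. destruct (proj2 Ht) as [H| ->]; [left; now apply ln_increasing | lra]. }
unfold Rpower. destruct (Req_dec (s' * ln t) (s * ln t)) as [->|Hne]; [lra|].
left. apply exp_increasing. nra.
Qed.

Lemma Hbound_Jset_above (d : nat) (E : list nat) s : (2 <= d)%nat ->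
  (forall e, In e E -> (e < d)%nat) -> (1 < length E)%nat -> INR (length E) < Rpower (INR d) s ->
  Hbound (fun t => Rpower t s) (Jset d E) 0.
Proof.
intros Hd HE Hc Hs eps eta He Heta. set (B := Rpower (INR d) s) in *.
assert (HD : 1 < INR d) by (apply (lt_INR 1); lia).
assert (Hk : 1 < INR (length E)) by (apply (lt_INR 1); lia).
destruct (inv_pow_small (INR d) eta HD Heta) as [n1 Hn1].
assert (HB : 1 < B / INR (length E)).
{ apply Rmult_lt_reg_r with (INR (length E)); [lra|]. unfold Rdiv. rewrite Rmult_assoc, Rinv_l by lra. lra. }
destruct (inv_pow_small _ eps HB He) as [n2 Hn2].
set (n := Nat.max n1 n2).
apply (cylinder_cover d E _ eta _ _ n (words E n)); auto.
- intros t _; left; apply Rpower_gt_0.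
- intros v [y [Hy Hv]]. exists y. split; auto. split; auto. now apply prefix_words.
- apply Hn1; unfold n; lia.
- rewrite INR_length_words, Rpower_inv, Rpower_pow_l by (try apply pow_lt; lra). fold B.
  specialize (Hn2 n ltac:(unfold n; lia)). rewrite <- pow_inv, Rinv_div in Hn2.
  unfold Rdiv in Hn2. rewrite Rpow_mult_distr, pow_inv in Hn2. lra.
Qed.

(** The limsup argument with empty blocks and [a] the zero sequence, all of J serving as [Q]. Single
    terms of the series are already unbounded because d^s < k. *)
Lemma Jset_not_Hbound_below (d : nat) (E : list nat) s : prime (Z.of_nat d) ->
  (forall e, In e E -> (e < d)%nat) -> NoDup E -> (1 < length E)%nat ->
  In 0%nat E -> (forall a b, In a E -> In b E -> a <> S b) ->
  0 < s -> Rpower (INR d) s < INR (length E) ->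
  forall b, ~ Hbound (fun t => Rpower t s) (Jset d E) b.
Proof.
intros Hd HE Hnd Hc H0 Hgap Hs Hlt.
assert (Hd2 := d_ge_2 d Hd). assert (HD : 1 < INR d) by (apply (lt_INR 1); lia).
set (B := Rpower (INR d) s) in *.
assert (HB : 1 < B) by (unfold B; rewrite <- (Rpower_O (INR d)) by lra; apply Rpower_lt; lra).
assert (HF : forall j, Rpower (/ INR d ^ j) s = / B ^ j).
{ intros j. rewrite Rpower_inv, Rpower_pow_l by (try apply pow_lt; lra). reflexivity. }
assert (HBp : forall j, 0 < B ^ j) by (intros; apply pow_lt; lra).
assert (Hunb : forall b, exists j, b <= INR (length E) ^ j * Rpower (/ INR d ^ j) s).
{ intros b. assert (HkB : 1 < INR (length E) / B).
  { apply Rmult_lt_reg_r with B; [lra|]. unfold Rdiv. rewrite Rmult_assoc, Rinv_l by lra. lra. }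
  destruct (Pow_x_infinity (INR (length E) / B)) with (b := b) as [N HN].
  { rewrite Rabs_right; lra. }
  exists N. specialize (HN N (le_n N)). rewrite Rabs_right in HN by (left; apply pow_lt; lra).
  unfold Rdiv in HN. rewrite Rpow_mult_distr, pow_inv in HN. rewrite HF. lra. }
apply (limsup_not_Hbound d E Hd HE Hnd Hc Hgap _ (fun _ => 0%nat) 0 (fun _ _ => 0%nat)).
- intros; apply Rpower_gt_0.
- intros u t Hu Ht. apply Rle_Rpower_l; lra.
- intros e He. exists (Rpower e (/ s)). split; [apply Rpower_gt_0|]. intros t Ht.
  apply Rlt_le_trans with (Rpower (Rpower e (/ s)) s).
  + apply Rlt_Rpower_l; lra.
  + rewrite Rpower_mult, Rinv_l, Rpower_1; lra.
- intros j. rewrite !HF. specialize (HBp j). simpl. rewrite Rinv_mult.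
  assert (0 < / B ^ j) by now apply Rinv_0_lt_compat.
  assert (1 <= INR (length E) * / B); [|nra].
  apply Rmult_le_reg_r with B; [lra|]. rewrite Rmult_assoc, Rinv_l; lra.
- exact Hunb.
- intros i; auto.
- intros _ b. destruct (Hunb (b * B)) as [j Hj]. exists (S j).
  apply Rle_trans with (INR (length E) ^ j * Rpower (/ INR d ^ (S j + 0)) s).
  + rewrite Nat.add_0_r. rewrite HF in *. specialize (HBp j). simpl. rewrite Rinv_mult.
    apply Rmult_le_reg_r with B; [lra|]. apply Rle_trans with (1 := Hj). apply Req_le. field; lra.
  + apply (lsum_ge_term (fun m => INR (length E) ^ m * Rpower (/ INR d ^ (S m + 0)) s)).
    * intros m. apply Rmult_le_pos; [apply pow_le, pos_INR | left; apply Rpower_gt_0].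
    * apply in_seq; lia.
- intros y v Hy Hv _. rewrite Rminus_0_r. now exists y.
Qed.

Lemma dimension_of_Jset (d : nat) (E : list nat) delta : prime (Z.of_nat d) ->
  (forall e, In e E -> (e < d)%nat) -> NoDup E -> (1 < length E)%nat ->
  In 0%nat E -> (forall a b, In a E -> In b E -> a <> S b) ->
  dimH (Jset d E) = Fin delta -> Rpower (INR d) delta = INR (length E).
Proof.
intros Hd HE Hnd Hc H0 Hgap Hdim.
assert (Hd2 := d_ge_2 d Hd). assert (HD : 1 < INR d) by (apply (lt_INR 1); lia).
assert (Hk : 1 < INR (length E)) by (apply (lt_INR 1); lia).
assert (HlD : 0 < ln (INR d)) by (rewrite <- ln_1; apply ln_increasing; lra).
assert (Hlk : 0 < ln (INR (length E))) by (rewrite <- ln_1; apply ln_increasing; lra).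
set (d0 := ln (INR (length E)) / ln (INR d)).
assert (Hd0 : 0 < d0) by now apply Rdiv_lt_0_compat.
assert (Hpow : Rpower (INR d) d0 = INR (length E)).
{ unfold Rpower, d0. replace (ln (INR (length E)) / ln (INR d) * ln (INR d)) with (ln (INR (length E)))
    by (field; lra). apply exp_ln; lra. }
enough (delta = d0) by now subst.
apply Rle_antisym.
- apply le_epsilon. intros eps He.
  enough (H : Rbar_le (Fin delta) (Fin (d0 + eps))) by exact H.
  rewrite <- Hdim. apply ERinf_lb. exists (d0 + eps). split; [lra|]. split; auto.
  apply Hmeas_null, Hbound_Jset_above; auto. rewrite <- Hpow. apply Rpower_lt; lra.
- enough (H : Rbar_le (Fin d0) (Fin delta)) by exact H.
  rewrite <- Hdim. apply ERinf_greatest. intros v [s [Hs [Hm ->]]]. simpl.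
  (* The exponent may be 0 in [dimH], while the lower bound needs a positive one; raising it to at
     least [d0 / 2] keeps it below [d0] and keeps the measure zero. *)
  apply Rnot_lt_le; intros Hlt. set (s' := Rmax s (d0 / 2)).
  assert (Hs1 := Rmax_l s (d0 / 2)). assert (Hs2 := Rmax_r s (d0 / 2)).
  assert (Hs3 : s' < d0) by (apply Rmax_lub_lt; lra).
  apply (Jset_not_Hbound_below d E s') with (b := 0); auto.
  + unfold s'; lra.
  + rewrite <- Hpow. apply Rpower_lt; auto.
  + apply (Hbound_gauge _ (fun t => Rpower t s)).
    * intros t Ht. now apply Rpower_le_exponent.
    * apply Hmeas_le_iff. rewrite Hm. apply Rbar_le_refl.
Qed.

Theorem theorem3p8
  (d : nat) (E : list nat)
  (hd : prime (Z.of_nat d))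
  (hEsub : forall e, In e E -> (e < d)%nat)
  (hEnodup : NoDup E)
  (hEcard : (1 < length E < d)%nat)
  (h0 : In 0%nat E) (hdm1 : In (d - 1)%nat E)
  (hgap : forall a b, In a E -> In b E -> a <> S b)
  (delta : R) (hdelta : dimH (Jset d E) = Fin delta) :
  exists N : R -> Prop,
    Hmeas (fun t => Rpower t delta) N = Fin 0 /\
    forall x : R, Jset d E x -> ~ N x ->
    forall psi : nat -> R, (forall n, (1 <= n)%nat -> 0 < psi n) ->
    forall f : R -> R, dimension_function f ->
    ((forall s t, 0 < s -> s <= t -> Rpower s (- delta) * f s <= Rpower t (- delta) * f t) \/
     (forall s t, 0 < s -> s <= t -> Rpower t (- delta) * f t <= Rpower s (- delta) * f s)) ->
    let term := fun n : nat =>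
      f (psi (d ^ S n)%nat / INR (d ^ S n)) * Rpower (INR (d ^ S n)) delta in
    ((exists l, infinite_sum term l) ->
       Hmeas f (WA_int (translate (Jset d E) x) psi) = Fin 0) /\
    (~ (exists l, infinite_sum term l) ->
       Hmeas f (WA_int (translate (Jset d E) x) psi) = Hmeas f (Jset d E)).
Proof.
destruct hEcard as [hcard _].
assert (hk : Rpower (INR d) delta = INR (length E)) by now apply (dimension_of_Jset d E).
exists (fun v => exists p q, (1 <= q)%nat /\ nonadic d q (IZR p / INR q) /\
     Jset d E v /\ Jset d E (v + IZR p / INR q)).
split; [now apply Hmeas_null, (exceptional_null d E)|].
intros x Hx HnN psi Hpsi f [Hmono [Hpos [_ Hlim]]] Hmon term.
assert (Hf : nonneg_gauge f) by (intros t Ht; left; auto).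
split; intros Hsum.
- apply Hmeas_null, (WA_null_of_convergence d E hd hEsub hcard delta hk x psi f); auto.
  intros p q Hq Hna HJ. apply HnN. now exists p, q.
- assert (HWJ : forall y, WA_int (translate (Jset d E) x) psi y -> Jset d E (y - - x)).
  { intros y [Hy _]. replace (y - - x) with (y + x) by ring. exact Hy. }
  (* When f(t) = O(t^delta), the translated set differs from J by an H^f-null set, so the two
     measures agree, whatever their value. *)
  assert (Hcritical : forall c, 0 < c -> (forall t, 0 < t <= 1 -> f t <= c * Rpower t delta) ->
    Hmeas f (WA_int (translate (Jset d E) x) psi) = Hmeas f (Jset d E)).
  { intros c Hc Hfc. apply Rbar_le_antisym; apply Hmeas_le_of_bounds; intros b.
    - now apply Hbound_translate with (- x).
    - intros HB. set (V := fun v => Jset d E v /\ ~ WA_int (translate (Jset d E) x) psi (v - x)).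
      apply (Hbound_split f _ (fun v => WA_int (translate (Jset d E) x) psi (v - x)) V b Hf).
      + intros v Hv. destruct (classic (WA_int (translate (Jset d E) x) psi (v - x))); [now left|].
        right; now split.
      + now apply (Hbound_translate f _ (WA_int (translate (Jset d E) x) psi) x).
      + now apply (WA_conull d E hd hEsub hEnodup hcard delta hk x psi f Hx Hpsi Hpos Hsum c). }
  assert (Hgauge : forall t c, 0 < t -> Rpower t (- delta) * f t <= c -> f t <= c * Rpower t delta).
  { intros t c Ht H. assert (HR := Rpower_gt_0 t delta). rewrite Rpower_Ropp in H.
    apply (Rmult_le_compat_l (Rpower t delta)) in H; [|lra].
    rewrite <- Rmult_assoc, Rinv_r in H by lra. lra. }
  destruct Hmon as [Hinc|Hdec].
  (* An increasing t^-delta f(t) is bounded on (0,1] by its value at 1. *)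
  + apply (Hcritical (Rpower 1 (- delta) * f 1)).
    * apply Rmult_lt_0_compat; [apply Rpower_gt_0 | apply Hpos; lra].
    * intros t Ht. apply Hgauge; [lra|]. now apply Hinc.
  + destruct (classic (exists c, forall t, 0 < t <= 1 -> Rpower t (- delta) * f t <= c)) as [[c Hc]|Hunb].
    * assert (Hc1 := Hc 1 ltac:(lra)).
      assert (0 < Rpower 1 (- delta) * f 1) by (apply Rmult_lt_0_compat; [apply Rpower_gt_0 | apply Hpos; lra]).
      apply (Hcritical c); [lra|]. intros t Ht. apply Hgauge; [lra | auto].
    (* Here both measures are infinite: a finite bound for J would pass to the well approximable
       set, a translate of a subset of J. *)
    * assert (HWA : forall b, ~ Hbound f (WA_int (translate (Jset d E) x) psi) b).
      { apply (WA_not_Hbound d E hd hEsub hEnodup hcard hgap delta hk x psi f); auto.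
        intros c. apply NNPP; intros Hn. apply Hunb. exists c. intros t Ht.
        apply Rnot_lt_le; intros Hlt. apply Hn. now exists t. }
      rewrite !Hmeas_infinite; auto.
      intros b HB. apply (HWA b). now apply (Hbound_translate f _ (Jset d E) (- x)).
Qed.
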